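(* Let $B\in\mathbb{Z}_{\ge 1}$, $t>0$ and $0<r\le 1$. (1) For every $\mu\prec B$, $$\mathbb{E}\big[|S_{t,T}-\hat S^{(\mathrm{GT})}_{t,T}|^2\big]\le (Br(r+1)-r)\,\mathbb{E}[S_t]+\mathbb{E}[S_{t,T}]\le B^2r(r+1)t.$$ (2) $$\inf_{\hat S_{t,T}}\ \sup_{\mu\prec B}\mathbb{E}\big[|S_{t,T}-\hat S_{t,T}|^2\big]\ge B^2rt,$$ the infimum being over all estimators. (3) $$\inf_{\hat S_{t,T}\in\mathrm{SEP}}\ \sup_{\mu\prec B}\mathbb{E}\big[|S_{t,T}-\hat S_{t,T}|^2\big]\ge B^2\Big(tr+\frac{r^2t^2}{t+1}\Big).$$ (4) With $r$ fixed, for any estimator $\hat S_{t,T}\in \mathrm{SEP}\cap\mathrm{AT}$ other than the Good--Toulmin estimator $\hat S^{(\mathrm{GT})}_{t,T}$, $$\sup_{\mu\prec B}\mathbb{E}\big[|S_{t,T}-\hat S_{t,T}|^2\big]\gtrsim B^2t^2,$$ where the implicit constant depends on the fixed value of $r$ and on the estimator $\hat S_{t,T}$ but not on $B$.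
   Context: Setting (Poissonized generalized unseen species problem). $\mathcal{S}$ is an at most countable set of species and $\mu$ is a probability measure on $2^{\mathcal S}$ supported on finite sets (the empty set may carry mass). $t,t'>0$, $r=t'/t$, $T=t+t'=(1+r)t$. Let $X_1,X_2,\dots$ be i.i.d. from $\mu$, and let $n\sim\mathrm{Poisson}(t)$, $m\sim\mathrm{Poisson}(t')$ be independent of each other and of the $X_i$. The first expedition observes $X_1,\dots,X_n$ (the data), the second $X_{n+1},\dots,X_{n+m}$. For $s\in\mathcal S$, $N_s$ is the number of sets observed in the first expedition that contain $s$, and $N_s'$ is the same count for the second expedition. $S_t=|\{s:N_s>0\}|$, $S_T=|\{s:N_s+N_s'>0\}|$, $S_{t,T}=S_T-S_t$. For $i\ge 1$, $\phi_i=|\{s:N_s=i\}|$ and $\boldsymbol\phi=(\phi_1,\phi_2,\dots)$ (a finitely supported sequence of nonnegative integers). $\mu\prec B$ ($B$-bounded arity) means $\mu(A)=0$ whenever $|A|>B$. Suprema over $\mu\prec B$ range over all such $\mu$ on all at most countable species sets $\mathcal S$. An estimator $\hat S_{t,T}$ is a real-valued function of the data $X_1,\dots,X_n$ (and of $r,t$), not depending on $\mu$. The class SEP (synchronous expeditions property): estimators that are functions of $r,t$ and $\boldsymbol\phi$ only and satisfy $\hat S_{t,T}(\boldsymbol\phi)+\hat S_{t,T}(\tilde{\boldsymbol\phi})=\hat S_{t,T}(\boldsymbol\phi+\tilde{\boldsymbol\phi})$ for all $\boldsymbol\phi,\tilde{\boldsymbol\phi}$. The class AT (atemporal): estimators that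 depend only on the data and $r$ (not explicitly on $t$). The Good--Toulmin estimator is $\hat S^{(\mathrm{GT})}_{t,T}=-\sum_{s\in\mathcal S}1_{N_s>0}(-r)^{N_s}$. $f(t)\gtrsim g(t)$ means there is a constant $c>0$ such that $f(t)\ge c\,g(t)$ for all sufficiently large $t$. *)

(* Defs.v *)
From HB Require Import structures.
From mathcomp Require Import all_boot all_order all_algebra finmap.
From mathcomp Require Import all_classical all_reals all_analysis.

Set Implicit Arguments.
Unset Strict Implicit.
Unset Printing Implicit Defensive.

Import Order.TTheory GRing.Theory Num.Theory.
Import numFieldNormedType.Exports.

Local Open Scope classical_set_scope.
Local Open Scope ring_scope.

(* One observed set of species.  A probability measure on 2^S supported on    *)
(* finite sets is a probability measure on the countable set of finite        *)
(* subsets of S, where every event is measurable.                             *)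
Definition sample (S : countType) := {fset S}.

HB.instance Definition _ (S : countType) := Countable.on (sample S).
HB.instance Definition _ (S : countType) := isPointed.Build (sample S) fset0%fset.
HB.instance Definition _ (S : countType) :=
  @isMeasurable.Build default_measure_display (sample S) discrete_measurable
    discrete_measurable0 discrete_measurableC discrete_measurableU.

Definition bounded_arity (R : realType) (S : countType) (B : nat)
    (mu : probability (sample S) R) : Prop :=
  forall A : sample S, (B < #|` A|)%N -> mu [set A] = 0%E.

Section Counts.
Variable S : countType.

Definition occ (D : seq (sample S)) (s : S) : nat := count (fun A : sample S => s \in A) D.

(* fset_set is junk on infinite sets; the sets below are all contained in the *)
(* finite union of the observed samples.                                      *)
Definition nseen (D : seq (sample S)) : nat := #|` fset_set [set s | (0 < occ D s)%N]|.

Definition nseen2 (D D' : seq (sample S)) : nat :=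
  #|` fset_set [set s | (0 < occ D s + occ D' s)%N]|.

(* Index shift: [phi D i] is the number of species seen exactly i + 1 times.  *)
Definition phi (D : seq (sample S)) : nat -> nat :=
  fun i => #|` fset_set [set s | occ D s = i.+1]|.

End Counts.

Definition nunseen (R : realType) (S : countType) (D D' : seq (sample S)) : R :=
  (nseen2 D D')%:R - (nseen D)%:R.

(* Arguments: r, t, the species set, and the first expedition's samples.      *)
Definition estimator (R : realType) : Type :=
  R -> R -> forall S : countType, seq (sample S) -> R.

Definition good_toulmin (R : realType) : estimator R := fun r _ S D =>
  - \sum_(s \in [set: S]) (0 < occ D s)%N%:R * (- r) ^+ occ D s.

Definition fin_supp (f : nat -> nat) : Prop := finite_set [set i | f i <> 0%N].

Definition SEP (R : realType) (est : estimator R) : Prop :=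
  exists g : R -> R -> (nat -> nat) -> R,
    (forall (r t : R) (S : countType) (D : seq (sample S)),
        0 < r -> 0 < t -> est r t S D = g r t (phi D)) /\
    (forall (r t : R) (f f' : nat -> nat),
        0 < r -> 0 < t -> fin_supp f -> fin_supp f' ->
        g r t f + g r t f' = g r t (fun i => (f i + f' i)%N)).

Definition AT (R : realType) (est : estimator R) : Prop :=
  forall (r t1 t2 : R) (S : countType) (D : seq (sample S)),
    0 < r -> 0 < t1 -> 0 < t2 -> est r t1 S D = est r t2 S D.

Section Model.
Context (R : realType) (S : countType) (d : measure_display)
  (Om : measurableType d) (P : probability Om R).
Variables (mu : probability (sample S) R) (r t : R).
Variables (X : nat -> {RV P >-> sample S}) (n m : {RV P >-> nat}).

(* The last clause is mutual independence of n, m, X 0, X 1, ...: taking some *)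
(* of the events to be full covers all finite subfamilies.  The law of m is   *)
(* Poisson(t') with t' = r t.                                                 *)
Definition poissonized_model : Prop :=
  [/\ forall (i : nat) (A : set (sample S)), distribution P (X i) A = mu A,
      forall k : nat, distribution P n [set k] = (poisson_pmf t k)%:E,
      forall k : nat, distribution P m [set k] = (poisson_pmf (r * t) k)%:E &
      forall (k : nat) (A C : set nat) (D : nat -> set (sample S)),
        P (n @^-1` A `&` m @^-1` C `&` \bigcap_(i in `I_k) (X i @^-1` D i)) =
        (P (n @^-1` A) * P (m @^-1` C) * \prod_(i < k) P (X i @^-1` D i))%E].

Definition first_expedition (w : Om) : seq (sample S) :=
  [seq X i w | i <- iota 0 (n w)].

Definition second_expedition (w : Om) : seq (sample S) :=
  [seq X i w | i <- iota (n w) (m w)].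

Definition mse (est : estimator R) : \bar R :=
  ('E_P[fun w => (`|nunseen R (first_expedition w) (second_expedition w)
                    - est r t S (first_expedition w)| ^+ 2)%R])%E.

Definition mean_seen : \bar R :=
  ('E_P[fun w => ((nseen (first_expedition w))%:R)%R])%E.

Definition mean_unseen : \bar R :=
  ('E_P[fun w => nunseen R (first_expedition w) (second_expedition w)])%E.

End Model.

(* The mean squared error depends on the realization (P, X, n, m) of the      *)
(* model only through mu, so this is the supremum over mu.                    *)
Definition worst_mse (R : realType) (B : nat) (r t : R) (est : estimator R) :
    \bar R :=
  ereal_sup [set x : \bar R |
    exists (S : countType) (mu : probability (sample S) R)
           (d : measure_display) (Om : measurableType d) (P : probability Om R)
           (X : nat -> {RV P >-> sample S}) (n m : {RV P >-> nat}),
      [/\ bounded_arity B mu, poissonized_model mu r t X n m &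
          x = mse r t X n m est]].

Definition minimax_mse (R : realType) (C : estimator R -> Prop) (B : nat)
    (r t : R) : \bar R :=
  ereal_inf [set x : \bar R |
    exists est : estimator R, C est /\ x = worst_mse B r t est].

(* Main.v *)
Require Import Defs.
From HB Require Import structures.
From mathcomp Require Import all_boot all_order all_algebra finmap.
From mathcomp Require Import all_classical all_reals all_analysis.
From mathcomp Require Import measurable_realfun ring lra.
Set Implicit Arguments.
Unset Strict Implicit.
Unset Printing Implicit Defensive.
Import Order.TTheory GRing.Theory Num.Theory.
Import numFieldNormedType.Exports.
Local Open Scope classical_set_scope.
Local Open Scope ring_scope.

(** Upper bound.  The error of the Good-Toulmin estimator is the sum over the
    species s of the terms (- r)^(N_s) - 1{N_s = N'_s = 0}.  Poisson sample sizes
    make every expectation of a product over the two expeditions an exponential: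
    E[prod u(X_i) prod v(X'_j)] = exp (t (E u - 1)) exp (r t (E v - 1))
    ([poisson_generating_functional]).  Hence each term is centered, and with
    x_s = t mu{s in A} and c = t mu{s, u in A} the terms of s and u have
    covariance exp (- (1 + r) (x_s + x_u - c)) (exp (r (1 + r) c) - 1)
    ([has_expectation_pair]).  By convexity of the exponential this is at most
    c / x_s times its value at u = s ([pair_bound]), and the c's of a fixed s add up
    to at most B x_s because a sample has at most B species.  So the variance is at
    most B times its diagonal, and convexity again turns the diagonal into mean
    numbers of seen and unseen species ([arity_bound]).  This is done for finite
    sets of species; Fatou's lemma passes to all of them.

    Lower bounds.  All use one family of models: M disjoint blocks of B species,
    each sample being a uniformly chosen block, so that every count of species is
    B times a count of blocks.  Given the first expedition, the number Y of new
    blocks has mean and variance close to r t when M is large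
    ([conditional_second_moment]), and the data carry no information on its
    fluctuation: this gives B^2 r t for any estimator.  As M tends to infinity no
    block is seen twice in the first expedition, where a SEP estimator is linear and
    can only answer B a n for a constant a; the error E (Y - a n)^2 tends to
    r t + E (r t - a n)^2, whose minimum over a is the bound for SEP estimators.

    For an atemporal SEP estimator the coefficients of the linear form do not
    depend on t.  If they are not those of Good-Toulmin, then with M proportional
    to t a block count is Poisson with a small parameter x of fixed size, and the
    bias per block is exp (- x) times the power series of the coefficient
    deviations, which for small x is dominated by its first nonzero term; the M
    blocks produce a bias of order B t ([bias_lower_bound]).  If that series has
    radius of convergence 0, a single block already makes the risk infinite
    ([single_block_lower_bound]).

    The models exist: the digits of a uniform real number in base M are
    independent and uniform ([digits_independent]), and a product with two Poisson
    laws provides the sample sizes ([uniform_realization]). *)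

(** * Expectations of real-valued functions *)

Section HasExpectation.
Context d (T : measurableType d) (R : realType) (P : probability T R).
Implicit Types F G : T -> R.

(** Integrability is part of the notion, so that linear combinations need no
    side conditions and values of sums can be read off from those of the terms. *)
Definition has_expectation F (v : R) :=
  P.-integrable setT (EFin \o F) /\ (\int[P]_x (F x)%:E = v%:E)%E.

Lemma has_expectation_eq F G v :
  F =1 G -> has_expectation F v -> has_expectation G v.
Proof. by move=> /funext ->. Qed.

Lemma has_expectation_unique F v w :
  has_expectation F v -> has_expectation F w -> v = w.
Proof. by move=> [_ Fv] [_]; rewrite Fv => -[]. Qed.

Lemma has_expectation_cst c : has_expectation (cst c) c.
Proof.
split; first exact: (@finite_measure_integrable_cst _ _ _ P).
rewrite -[LHS]/(\int[P]_x (cst c%:E x))%E integral_cst//=.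
by rewrite probability_setT mule1.
Qed.

Lemma has_expectationD F G v w : has_expectation F v -> has_expectation G w ->
  has_expectation (fun x => F x + G x) (v + w).
Proof.
move=> [iF Fv] [iG Gw]; split.
  by have -> : EFin \o (fun x => F x + G x) = (EFin \o F) \+ (EFin \o G) by [];
    exact: integrableD.
by apply: etrans (integralD_EFin measurableT iF iG) _; rewrite /= Fv Gw.
Qed.

Lemma has_expectationZ c F v : has_expectation F v ->
  has_expectation (fun x => c * F x) (c * v).
Proof.
move=> [iF Fv]; split.
  exact: (integrableZl measurableT c iF).
by apply: etrans (integralZl measurableT iF c) _; rewrite /= Fv.
Qed.

Lemma has_expectationB F G v w : has_expectation F v -> has_expectation G w ->
  has_expectation (fun x => F x - G x) (v - w).
Proof.
move=> Fv Gw; rewrite -(mulN1r w).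
apply: has_expectation_eq (has_expectationD Fv (has_expectationZ (-1) Gw)) => x.
by rewrite mulN1r.
Qed.

Lemma has_expectation_sum (I : Type) (s : seq I) (F : I -> T -> R) (v : I -> R) :
  (forall i, has_expectation (F i) (v i)) ->
  has_expectation (fun x => \sum_(i <- s) F i x) (\sum_(i <- s) v i).
Proof.
move=> Fv; elim: s => [|i s IHs].
  rewrite big_nil; apply: has_expectation_eq (has_expectation_cst 0) => x.
  by rewrite big_nil.
rewrite big_cons; apply: has_expectation_eq (has_expectationD (Fv i) IHs) => x.
by rewrite big_cons.
Qed.

Lemma has_expectation_indic (A : set T) v : measurable A -> P A = v%:E ->
  has_expectation \1_A v.
Proof.
move=> mA PA; split; last by rewrite integral_indic// setIT.
exact: (integrable_indic P mA).
Qed.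

Lemma has_expectation_le F G v w : (forall x, F x <= G x) ->
  has_expectation F v -> has_expectation G w -> v <= w.
Proof.
move=> FG [iF Fv] [iG Gw]; rewrite -lee_fin -Fv -Gw.
by apply: le_integral => // x _; rewrite lee_fin.
Qed.

(** The integral on the right may be infinite, as the risk of an arbitrary
    estimator may be. *)
Lemma has_expectation_le_integral F G v : measurable_fun setT G ->
  (forall x, F x <= G x) -> (forall x, 0 <= G x) -> has_expectation F v ->
  (v%:E <= \int[P]_x (G x)%:E)%E.
Proof.
move=> mG FG G0 [iF Fv].
have [oo|fin] := eqVneq (\int[P]_x (G x)%:E)%E +oo%E; first by rewrite oo leey.
rewrite -Fv; apply: le_integral => //; last by move=> x _; rewrite lee_fin.
apply/integrableP; split; first exact/measurable_EFinP.
under eq_integral do rewrite /= ger0_norm//.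
by rewrite ltey.
Qed.

Lemma bounded_has_expectation F (c : R) : measurable_fun setT F ->
  (forall x, `|F x| <= c) -> exists v, has_expectation F v.
Proof.
move=> mF Fc.
have iF : P.-integrable setT (EFin \o F).
  apply: (@measurable_bounded_integrable _ _ _ P) => //.
    exact: fin_num_fun_lty.
  by exists c; split; [exact: num_real|move=> x cx y _; exact: le_trans (Fc y) (ltW cx)].
exists (fine (\int[P]_x (F x)%:E)%E); split => //.
by rewrite fineK// (integrable_fin_num measurableT iF).
Qed.

End HasExpectation.

(** * Random variables with countably many values *)

Section CountableValued.
Context d (Om : measurableType d) (R : realType).

Lemma measurable_preimage_countable (T : countType) (Y : Om -> T) :
  (forall y, measurable [set w | Y w = y]) -> forall A, measurable (Y @^-1` A).
Proof.
move=> mY A.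
have -> : Y @^-1` A = \bigcup_(y in A) [set w | Y w = y].
  by apply/seteqP; split=> [w Aw|w /= [y + ->]//]; exists (Y w).
rewrite bigcup_mkcond; apply: countable_bigcupT_measurable; first exact: countableP.
by move=> y; case: ifP.
Qed.

Lemma measurable_comp_countable (T : countType) (Y : Om -> T) (h : T -> R) :
  (forall y, measurable [set w | Y w = y]) -> measurable_fun setT (h \o Y).
Proof.
by move=> mY _ B _; rewrite setTI comp_preimage; exact: measurable_preimage_countable.
Qed.

Variable P : probability Om R.

(** The law of total expectation over the values of N.  Boundedness gives dominated
    convergence, so the terms g k may have any sign. *)
Lemma has_expectation_series (N : Om -> nat) (F : Om -> R) (g : nat -> R) (G c : R) :
  (forall k, measurable [set w | N w = k]) -> measurable_fun setT F ->
  (forall w, `|F w| <= c) ->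
  (forall k, has_expectation P (fun w => (N w == k)%:R * F w) (g k)) ->
  series g @ \oo --> G -> has_expectation P F G.
Proof.
move=> mN mF Fc Fg gG.
pose F_ k := fun w => (N w < k)%:R * F w.
have F_g k : has_expectation P (F_ k) (series g k).
  apply: has_expectation_eq (has_expectation_sum (index_iota 0 k) Fg) => w.
  rewrite -mulr_suml /F_; congr (_ * _).
  elim: k => [|k IHk]; first by rewrite big_geq.
  rewrite big_nat_recr//= IHk ltnS (leq_eqVlt (N w)) -natrD.
  by case: (ltngtP (N w) k).
have mF_ k : measurable_fun setT (EFin \o F_ k).
  by have [/integrableP[]] := F_g k.
have F_F w : setT w -> (EFin \o F_ k) w @[k --> \oo] --> (EFin \o F) w.
  move=> _; apply: cvg_near_cst; exists (N w).+1 => // k /= Nk.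
  by rewrite /F_ Nk mul1r.
have ic : P.-integrable setT (EFin \o cst c).
  by have [] := has_expectation_cst P c.
have F_c k w : setT w -> (`|(EFin \o F_ k) w| <= (EFin \o cst c) w)%E.
  move=> _; rewrite lee_fin /F_ normrM; apply: le_trans (Fc w).
  by rewrite ler_piMl// normr_nat lern1 leq_b1.
have mEF : measurable_fun setT (EFin \o F) by exact/measurable_EFinP.
have [iF _] := dominated_convergence measurableT mF_ mEF (aeW P F_F) ic
  (aeW P (fun w n => @F_c n w)).
move=> FF; split => //; move: FF.
have -> : (fun n => \int[P]_(x in setT) (EFin \o F_ n) x)%E = EFin \o series g.
  by apply/funext => k; have [_ ->] := F_g k.
move=> FF; have gE : (EFin \o series g) @ \oo --> G%:E by
  apply: cvg_EFin => //; exact: nearW.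
exact: (cvg_unique _ FF gE).
Qed.

End CountableValued.

(** * The two expeditions *)

Section Expeditions.
Context d (Om : measurableType d) (T : countType).
Variables (L : nat -> Om -> T) (n m : Om -> nat).

Definition first_obs (w : Om) : seq T := [seq L i w | i <- iota 0 (n w)].
Definition second_obs (w : Om) : seq T := [seq L i w | i <- iota (n w) (m w)].

Hypothesis mn : forall k, measurable [set w | n w = k].
Hypothesis mm : forall k, measurable [set w | m w = k].
Hypothesis mL : forall i x, measurable [set w | L i w = x].

Let measurable_map_obs (s : seq nat) (x : seq T) :
  measurable [set w | [seq L i w | i <- s] = x].
Proof.
elim: s x => [|i s IHs] [|a x] /=.
- by rewrite (_ : [set _ | _] = setT)//; apply/seteqP; split.
- by rewrite (_ : [set _ | _] = set0)//; apply/seteqP; split.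
- by rewrite (_ : [set _ | _] = set0)//; apply/seteqP; split.
- rewrite (_ : [set _ | _] = [set w | L i w = a] `&`
    [set w | [seq L i w | i <- s] = x]); first exact: measurableI.
  by apply/seteqP; split=> [w /= [-> ->]//|w /= [-> ->]].
Qed.

(** The pair of expeditions has countably many values, so every statistic of it
    is measurable. *)
Lemma measurable_obs (R : realType) (h : seq T -> seq T -> R) :
  measurable_fun setT (fun w => h (first_obs w) (second_obs w)).
Proof.
apply: (measurable_comp_countable (Y := fun w => (first_obs w, second_obs w))
  (fun p => h p.1 p.2)) => -[x y].
rewrite (_ : [set _ | _] = \bigcup_(p : nat * nat)
   ([set w | n w = p.1] `&` [set w | m w = p.2] `&`
    [set w | [seq L i w | i <- iota 0 p.1] = x] `&`
    [set w | [seq L i w | i <- iota p.1 p.2] = y])); last first.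
  apply/seteqP; split=> [w /= [<- <-]|w [[k l] _] /= [[[<- <-] xE] yE]].
    by exists (n w, m w).
  by rewrite /first_obs /second_obs xE yE.
apply: countable_bigcupT_measurable => // p.
by do !apply: measurableI.
Qed.

End Expeditions.

(** * Poisson series *)

Section PoissonSeries.
Context (R : realType).

Lemma poisson_pmfE (a : R) k : 0 < a ->
  poisson_pmf a k = expR (- a) * (a ^+ k / k`!%:R).
Proof. by move=> a0; rewrite /poisson_pmf a0 mulrC. Qed.

Lemma cvg_seriesMl (u : nat -> R) (c l : R) :
  series u @ \oo --> l -> series (fun k => c * u k) @ \oo --> c * l.
Proof.
move=> ul; rewrite (_ : series _ = (fun k => c * series u k)).
  exact: cvgMr.
by apply/funext => k; rewrite /series/= mulr_sumr.
Qed.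

Lemma cvg_series_poisson_gen (a z : R) : 0 < a ->
  series (fun k => poisson_pmf a k * z ^+ k) @ \oo --> expR (a * (z - 1)).
Proof.
move=> a0.
rewrite (_ : (fun k => _) = (fun k => expR (- a) * exp_coeff (a * z) k)); last first.
  by apply/funext => k; rewrite poisson_pmfE// /exp_coeff/= exprMn; ring.
rewrite mulrBr mulr1 addrC expRD; apply: cvg_seriesMl.
exact: is_cvg_series_exp_coeff.
Qed.

End PoissonSeries.

(** * Independent labels in Poisson number *)

Section PoissonLabels.
Context d (Om : measurableType d) (R : realType) (P : probability Om R).
Variable C : finType.

(** The joint law of two independent Poisson sample sizes and of i.i.d. labels
    with values in a finite type, stated on the atoms that determine it. *)
Definition poisson_labels (a b : R) (p : C -> R) (n m : Om -> nat)
    (L : nat -> Om -> C) : Prop :=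
  [/\ forall k, measurable [set w | n w = k],
      forall k, measurable [set w | m w = k],
      forall i c, measurable [set w | L i w = c] &
      forall K k l (c : 'I_K -> C),
        P [set w | [/\ n w = k, m w = l & forall i : 'I_K, L i w = c i]] =
        (poisson_pmf a k * poisson_pmf b l * \prod_i p (c i))%:E].

Variables (a b : R) (p : C -> R) (n m : Om -> nat) (L : nat -> Om -> C).
Hypothesis (a0 : 0 < a) (b0 : 0 < b).
Hypothesis labels : poisson_labels a b p n m L.

Let mn k : measurable [set w | n w = k]. Proof. by case: labels. Qed.
Let mm k : measurable [set w | m w = k]. Proof. by case: labels. Qed.
Let mL i c : measurable [set w | L i w = c]. Proof. by case: labels. Qed.

(** Expanding each factor over the finitely many labels reduces the expectation to
    the probabilities of the atoms. *)
Lemma has_expectation_prod K k l (f : nat -> C -> R) :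
  has_expectation P
    (fun w => (n w == k)%:R * (m w == l)%:R * \prod_(i < K) f i (L i w))
    (poisson_pmf a k * poisson_pmf b l * \prod_(i < K) \sum_c f i c * p c).
Proof.
pose E (c : {ffun 'I_K -> C}) :=
  [set w | [/\ n w = k, m w = l & forall i : 'I_K, L i w = c i]].
have mE c : measurable (E c).
  rewrite (_ : E c = [set w | n w = k] `&` [set w | m w = l] `&`
     \bigcap_(i in [set: 'I_K]) [set w | L i w = c i]).
    by do !apply: measurableI => //; exact: fin_bigcap_measurable.
  apply/seteqP; split=> w /=.
    by move=> [? ? Lc]; split => // i _ /=.
  by move=> [[? ?] Lc]; split => // i; exact: (Lc i I).
have EP (c : {ffun 'I_K -> C}) : has_expectation P \1_(E c)
    (poisson_pmf a k * poisson_pmf b l * \prod_i p (c i)).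
  by apply: has_expectation_indic => //; case: labels => _ _ _ /(_ K k l c).
have := has_expectation_sum (index_enum {ffun 'I_K -> C})
  (fun c => has_expectationZ (\prod_(i < K) f i (c i)) (EP c)).
have -> : \sum_(c : {ffun 'I_K -> C}) (\prod_(i < K) f i (c i)) *
    (poisson_pmf a k * poisson_pmf b l * \prod_(i < K) p (c i)) =
    poisson_pmf a k * poisson_pmf b l * \prod_(i < K) \sum_c f i c * p c.
  rewrite bigA_distr_bigA/= mulr_sumr; apply: eq_bigr => c _.
  by rewrite big_split/= mulrCA.
apply: has_expectation_eq => w.
pose c0 : {ffun 'I_K -> C} := [ffun i : 'I_K => L i w].
rewrite (bigD1 c0)//= [X in _ + X]big1 ?addr0 => [|c cc0]; last first.
  rewrite ?indicE memNset ?mulr0// => -[_ _ Lc].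
  by move/eqP: cc0; apply; apply/ffunP => i; rewrite ffunE Lc.
rewrite mulrC; congr (_ * _); last by apply: eq_bigr => i _; rewrite ffunE.
rewrite ?indicE -natrM mulnb; congr ((nat_of_bool _)%:R).
apply/idP/andP => [/set_mem[-> ->]|[/eqP nk /eqP ml]]; first by rewrite !eqxx.
by rewrite mem_set//; split => // i; rewrite ffunE.
Qed.

Lemma norm_prod_le1 I (s : seq I) (Q : pred I) (F : I -> R) :
  (forall i, `|F i| <= 1) -> `|\prod_(i <- s | Q i) F i| <= 1.
Proof.
move=> F1; rewrite normr_prod Num.Theory.prodr_ile1// => i _.
by rewrite normr_ge0 F1.
Qed.

(** Summing over the value of m turns the second product into an exponential,
    while n stays fixed: this form also describes events of the first expedition,
    through indicator functions f. *)
Lemma has_expectation_first_second k (f : nat -> C -> R) (v : C -> R) :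
  (forall i c, `|f i c| <= 1) -> (forall c, `|v c| <= 1) ->
  has_expectation P
    (fun w => (n w == k)%:R * \prod_(i < k) f i (L i w)
              * \prod_(c <- second_obs L n m w) v c)
    (poisson_pmf a k * \prod_(i < k) (\sum_c f i c * p c)
       * expR (b * (\sum_c v c * p c - 1))).
Proof.
move=> f1 v1.
set A := poisson_pmf a k * _; set V := \sum_c v c * p c.
apply: (@has_expectation_series _ _ _ P m _
  (fun l => A * (poisson_pmf b l * V ^+ l)) _ 1) => //.
- apply: measurable_funM.
    apply: measurable_funM.
      exact: (measurable_comp_countable (fun x => (x == k)%:R)).
    apply: measurable_prod => i _.
    exact: (measurable_comp_countable (f i)).
  exact: (measurable_obs mn mm mL (fun _ y => \prod_(c <- y) v c)).
- move=> w; rewrite !normrM mulr_ile1 ?mulr_ge0 ?norm_prod_le1//.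
  by rewrite mulr_ile1 ?norm_prod_le1// normr_nat lern1 leq_b1.
- move=> l; pose f' i := if (i < k)%N then f i else v.
  have := has_expectation_prod (k + l) k l f'.
  rewrite big_split_ord/= (eq_bigr (fun i : 'I_k => \sum_c f i c * p c)); last first.
    by move=> i _; rewrite /f' ltn_ord.
  rewrite [X in _ * _ * (_ * X)](eq_bigr (fun=> V)); last first.
    by move=> i _; rewrite /f' ltnNge leq_addr.
  rewrite prodr_const card_ord.
  have -> : poisson_pmf a k * poisson_pmf b l *
      ((\prod_(i < k) \sum_c f i c * p c) * V ^+ l) = A * (poisson_pmf b l * V ^+ l).
    by rewrite /A -!mulrA; congr (_ * _); rewrite mulrCA.
  apply: has_expectation_eq => w.
  have [nk|nk] := eqVneq (n w) k; last by rewrite !(mul0r, mulr0).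
  have [ml|ml] := eqVneq (m w) l; last by rewrite !(mul0r, mulr0).
  rewrite !mul1r big_split_ord/=; congr (_ * _).
    by apply: eq_bigr => i _; rewrite /f' ltn_ord.
  rewrite /second_obs nk ml big_map -[in RHS](addn0 k) iotaDl big_map.
  have -> : iota 0 l = index_iota 0 l by rewrite /index_iota subn0.
  rewrite big_mkord.
  by apply: eq_bigr => i _; rewrite /f' ltnNge leq_addr.
- apply: cvg_seriesMl; exact: cvg_series_poisson_gen.
Qed.

(** Summing over n as well turns both products into exponentials. *)
Lemma poisson_generating_functional (u v : C -> R) :
  (forall c, `|u c| <= 1) -> (forall c, `|v c| <= 1) ->
  has_expectation P
    (fun w => (\prod_(c <- first_obs L n w) u c)
              * \prod_(c <- second_obs L n m w) v c)
    (expR (a * (\sum_c u c * p c - 1)) * expR (b * (\sum_c v c * p c - 1))).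
Proof.
move=> u1 v1; set U := \sum_c u c * p c; set V := expR (b * _).
apply: (@has_expectation_series _ _ _ P n _
  (fun k => V * (poisson_pmf a k * U ^+ k)) _ 1) => //.
- exact: (measurable_obs mn mm mL
    (fun x y => (\prod_(c <- x) u c) * \prod_(c <- y) v c)).
- by move=> w; rewrite normrM mulr_ile1// norm_prod_le1.
- move=> k; have := has_expectation_first_second k (fun=> u1) v1.
  rewrite prodr_const card_ord -/U -/V (mulrC _ V).
  apply: has_expectation_eq => w.
  have [nk|nk] := eqVneq (n w) k; last by rewrite !mul0r.
  rewrite !mul1r; congr (_ * _).
  rewrite /first_obs nk big_map.
  have -> : iota 0 k = index_iota 0 k by rewrite /index_iota subn0.
  by rewrite big_mkord.
- rewrite (mulrC _ V); apply: cvg_seriesMl; exact: cvg_series_poisson_gen.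
Qed.

End PoissonLabels.

(** * Labels of the samples of a Poissonized model *)

Section PoissonizedLabels.
Context (R : realType) (S : countType) d (Om : measurableType d)
  (P : probability Om R) (mu : probability (sample S) R) (r t : R)
  (X : nat -> {RV P >-> sample S}) (n m : {RV P >-> nat}).
Hypothesis model : poissonized_model mu r t X n m.

Definition frequency (Q : pred (sample S)) : R := fine (mu [set A | Q A]).

Lemma has_expectation_frequency (Q : pred (sample S)) :
  has_expectation mu (fun A => (Q A)%:R) (frequency Q).
Proof.
have := @has_expectation_indic _ _ _ mu [set A | Q A] (frequency Q).
move=> /(_ _ _)/(has_expectation_eq _); apply => //.
- by move=> A; rewrite indicE; congr ((nat_of_bool _)%:R); apply/idP/idP => [/set_mem|/mem_set].
- by rewrite fineK// fin_num_measure.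
Qed.

(** A classification of the samples into finitely many classes preserves the
    independence, whatever the number of species. *)
Lemma poissonized_model_labels (C : finType) (k : sample S -> C) :
  poisson_labels P t (r * t) (fun c => frequency (fun A => k A == c))
    n m (fun i w => k (X i w)).
Proof.
have mX i (A : set (sample S)) : measurable (X i @^-1` A).
  exact: measurable_funPTI.
have [Xmu nt mt indep] := model.
split.
- by move=> j; exact: (measurable_funPTI n (_ : measurable [set j])).
- by move=> j; exact: (measurable_funPTI m (_ : measurable [set j])).
- by move=> i c; exact: (mX i [set A | k A = c]).
move=> K j l c.
(* the model indexes events by nat: beyond K they are full *)
pose D i : set (sample S) := if insub i is Some i' then [set A | k A = c i'] else setT.
have DE (i : 'I_K) : D i = [set A | k A = c i].
  by rewrite /D valK.
have := indep K [set j] [set l] D.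
rewrite (_ : _ `&` _ `&` _ =
    [set w | [/\ n w = j, m w = l & forall i : 'I_K, k (X i w) = c i]]); last first.
  apply/seteqP; split => w /=.
    move=> [[-> ->] XD]; split => // i.
    by have := XD i (ltn_ord i); rewrite DE.
  move=> [-> -> XD]; split => // i iK.
  by have := XD (Ordinal iK); rewrite -[X in D X]/(val (Ordinal iK)) DE.
move=> ->; rewrite !EFinM -(nt j) -(mt l); congr (_ * _)%E.
rewrite -prodEFin; apply: eq_bigr => i _.
rewrite DE; transitivity (mu [set A | k A = c i]); first exact: (Xmu i).
rewrite /frequency fineK ?fin_num_measure//; congr (mu _).
by apply/seteqP; split=> A /= /eqP.
Qed.

Hypotheses (r0 : 0 < r) (t0 : 0 < t).

Lemma sample_generating_functional (C : finType) (k : sample S -> C)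
    (u v : C -> R) U V :
  (forall c, `|u c| <= 1) -> (forall c, `|v c| <= 1) ->
  has_expectation mu (u \o k) U -> has_expectation mu (v \o k) V ->
  has_expectation P
    (fun w => (\prod_(A <- first_expedition X n w) u (k A))
              * \prod_(A <- second_expedition X n m w) v (k A))
    (expR (t * (U - 1)) * expR (r * t * (V - 1))).
Proof.
have sumE (f : C -> R) z : has_expectation mu (f \o k) z ->
    \sum_c f c * frequency (fun A => k A == c) = z.
  apply: has_expectation_unique.
  apply: has_expectation_eq (has_expectation_sum (index_enum C)
    (fun c => has_expectationZ (f c) (has_expectation_frequency (fun A => k A == c)))).
  move=> A; rewrite (bigD1 (k A))//= eqxx mulr1 big1 ?addr0// => c.
  by rewrite eq_sym => /negbTE ->; rewrite mulr0.
move=> u1 v1 /sumE <- /sumE <-.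
have := poisson_generating_functional t0 (mulr_gt0 r0 t0)
  (poissonized_model_labels k) u1 v1.
apply: has_expectation_eq => w.
rewrite /first_obs /second_obs /first_expedition /second_expedition.
by rewrite !big_map.
Qed.

End PoissonizedLabels.

(** * Covariances of the Good-Toulmin error *)

Section GoodToulmin.
Context (R : realType).

(** The form (- r)^N - 1{N = N' = 0} covers the three cases of a species that is
    seen, newly found, or never seen, and has mean 0. *)
Definition species_error (S : countType) (r : R) (D D' : seq (sample S)) (s : S) : R :=
  (- r) ^+ occ D s - (occ D s + occ D' s == 0)%N%:R.

(** Powers and vanishing of an occurrence number are products over the samples,
    the form to which the generating functional applies. *)
Lemma exp_occ (S : countType) (x : R) (D : seq (sample S)) s :
  x ^+ occ D s = \prod_(A <- D) (if s \in (A : {fset S}) then x else 1).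
Proof.
elim: D => [|A D IHD]; first by rewrite big_nil.
by rewrite big_cons -IHD /occ/=; case: ifP => _; rewrite ?exprS ?mul1r.
Qed.

Lemma occ_eq0_prod (S : countType) (D : seq (sample S)) s :
  (occ D s == 0)%N%:R = \prod_(A <- D) (s \notin (A : {fset S}))%:R :> R.
Proof.
elim: D => [|A D IHD]; first by rewrite big_nil.
rewrite big_cons -IHD /occ/=; case: (s \in _); first by rewrite mul0r.
by rewrite mul1r.
Qed.

Section PairMoments.
Context (S : countType) d (Om : measurableType d)
  (P : probability Om R) (mu : probability (sample S) R) (r t : R)
  (X : nat -> {RV P >-> sample S}) (n m : {RV P >-> nat}).
Hypothesis model : poissonized_model mu r t X n m.
Hypotheses (r0 : 0 < r) (r1 : r <= 1) (t0 : 0 < t).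

Let p (s : S) := frequency mu (fun A => s \in (A : {fset S})).
Let p2 (s u : S) :=
  frequency mu (fun A => (s \in (A : {fset S})) && (u \in (A : {fset S}))).
Let fe := first_expedition X n.
Let se := second_expedition X n m.

Let pE s : has_expectation mu (fun A : sample S => (s \in (A : {fset S}))%:R) (p s).
Proof. exact: has_expectation_frequency. Qed.
Let p2E s u : has_expectation mu
  (fun A => ((s \in (A : {fset S})) && (u \in (A : {fset S})))%:R) (p2 s u).
Proof. exact: has_expectation_frequency. Qed.

Lemma has_expectation_unseen s : has_expectation P
  (fun w => (occ (fe w) s == 0)%N%:R) (expR (- (t * p s))).
Proof.
have b1 (b : bool) : `|(~~ b)%:R : R| <= 1 by rewrite normr_nat lern1 leq_b1.
have n11 (b : bool) : `|1 : R| <= 1 by rewrite normr1.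
have H : has_expectation mu
    ((fun b : bool => (~~ b)%:R) \o (fun A : sample S => s \in (A : {fset S}))) (1 - p s).
  apply: has_expectation_eq (has_expectationB (has_expectation_cst mu 1) (pE s)) => A /=.
  by case: (s \in _); rewrite ?subrr ?subr0.
have := sample_generating_functional model r0 t0 b1 n11 H (has_expectation_cst mu 1).
rewrite subrr mulr0 expR0 mulr1 addrAC subrr add0r mulrN.
apply: has_expectation_eq => w.
by rewrite occ_eq0_prod [X in _ * X]big1 ?mulr1.
Qed.

Lemma has_expectation_never_seen s : has_expectation P
  (fun w => (occ (fe w) s + occ (se w) s == 0)%N%:R) (expR (- ((1 + r) * (t * p s)))).
Proof.
have b1 : forall c : bool, `|(~~ c)%:R : R| <= 1.
  by move=> c; rewrite normr_nat lern1 leq_b1.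
have H : has_expectation mu
    ((fun b : bool => (~~ b)%:R) \o (fun A : sample S => s \in (A : {fset S}))) (1 - p s).
  apply: has_expectation_eq (has_expectationB (has_expectation_cst mu 1) (pE s)) => A /=.
  by case: (s \in _); rewrite ?subrr ?subr0.
have := sample_generating_functional model r0 t0 b1 b1 H H.
rewrite -expRD (_ : _ + _ = - ((1 + r) * (t * p s))); last by ring.
apply: has_expectation_eq => w.
by rewrite -!occ_eq0_prod -natrM mulnb addn_eq0.
Qed.

(** The product expands into four products over the samples.  Three of them have
    the same expectation exp (- (1 + r) t q), where q is the frequency of the samples that
    contain s or u; only the one that involves no indicator of absence differs. *)
Lemma has_expectation_pair s u : has_expectation P
  (fun w => species_error r (fe w) (se w) s * species_error r (fe w) (se w) u)
  (expR (- ((1 + r) * (t * (p s + p u - p2 s u)))) *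
   (expR (r * (1 + r) * (t * p2 s u)) - 1)).
Proof.
pose k (A : sample S) := (s \in (A : {fset S}), u \in (A : {fset S})).
pose gf := sample_generating_functional (k := k) model r0 t0.
have n1 (b : bool) : `|(if b then - r else 1)| <= 1.
  by case: b; rewrite ?normrN ?normr1// gtr0_norm.
have b1 (b : bool) : `|(~~ b)%:R : R| <= 1 by rewrite normr_nat lern1 leq_b1.
have E1 := has_expectation_cst mu (1 : R).
(* each factor is a function of the two membership bits, hence a combination
   of 1, [s in A], [u in A] and [s, u in A] *)
have noneE : has_expectation mu
    ((fun c : bool * bool => (~~ c.1)%:R * (~~ c.2)%:R) \o k) (1 - (p s + p u - p2 s u)).
  apply: has_expectation_eq (has_expectationB E1 (has_expectationB
    (has_expectationD (pE s) (pE u)) (p2E s u))) => A /=.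
  by case: (s \in _); case: (u \in _) => /=; ring.
have signE : has_expectation mu
    ((fun c : bool * bool => (if c.1 then - r else 1) * (if c.2 then - r else 1)) \o k)
    (1 - (1 + r) * (p s + p u - p2 s u) + r * (1 + r) * p2 s u).
  apply: has_expectation_eq (has_expectationD (has_expectationB E1
    (has_expectationZ (1 + r) (has_expectationB
    (has_expectationD (pE s) (pE u)) (p2E s u))))
    (has_expectationZ (r * (1 + r)) (p2E s u))) => A /=.
  by case: (s \in _); case: (u \in _) => /=; ring.
have sfE : has_expectation mu
    ((fun c : bool * bool => (if c.1 then - r else 1) * (~~ c.2)%:R) \o k)
    (1 - p u - (1 + r) * (p s - p2 s u)).
  apply: has_expectation_eq (has_expectationB (has_expectationB E1 (pE u))
    (has_expectationZ (1 + r) (has_expectationB (pE s) (p2E s u)))) => A /=.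
  by case: (s \in _); case: (u \in _) => /=; ring.
have fsE : has_expectation mu
    ((fun c : bool * bool => (~~ c.1)%:R * (if c.2 then - r else 1)) \o k)
    (1 - p s - (1 + r) * (p u - p2 s u)).
  apply: has_expectation_eq (has_expectationB (has_expectationB E1 (pE s))
    (has_expectationZ (1 + r) (has_expectationB (pE u) (p2E s u)))) => A /=.
  by case: (s \in _); case: (u \in _) => /=; ring.
have uE : has_expectation mu ((fun c : bool * bool => (~~ c.2)%:R) \o k) (1 - p u).
  apply: has_expectation_eq (has_expectationB E1 (pE u)) => A /=.
  by case: (u \in _) => /=; ring.
have sE : has_expectation mu ((fun c : bool * bool => (~~ c.1)%:R) \o k) (1 - p s).
  apply: has_expectation_eq (has_expectationB E1 (pE s)) => A /=.
  by case: (s \in _) => /=; ring.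
have le11 (x y : R) : `|x| <= 1 -> `|y| <= 1 -> `|x * y| <= 1.
  by move=> ? ?; rewrite normrM mulr_ile1.
have bb c := le11 _ _ (b1 c.1) (b1 c.2).
have n11 (c : bool * bool) : `|1 : R| <= 1 by rewrite normr1.
have G1 := gf _ _ _ _ (fun c => le11 _ _ (n1 c.1) (n1 c.2)) n11 signE E1.
have G2 := gf _ _ _ _ (fun c => le11 _ _ (n1 c.1) (b1 c.2)) (fun c => b1 c.2) sfE uE.
have G3 := gf _ _ _ _ (fun c => le11 _ _ (b1 c.1) (n1 c.2)) (fun c => b1 c.1) fsE sE.
have G4 := gf _ _ _ _ bb bb noneE noneE.
have := has_expectationD (has_expectationB (has_expectationB G1 G2) G3) G4.
rewrite -!expRD.
set e1 := expR _; set e2 := expR _; set e3 := expR _; set e4 := expR _.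
set q := p s + p u - p2 s u.
have -> : e1 = expR (- ((1 + r) * (t * q))) * expR (r * (1 + r) * (t * p2 s u)).
  by rewrite -expRD; congr expR; rewrite /q; ring.
have -> : e2 = expR (- ((1 + r) * (t * q))) by congr expR; rewrite /q; ring.
have -> : e3 = expR (- ((1 + r) * (t * q))) by congr expR; rewrite /q; ring.
have -> : e4 = expR (- ((1 + r) * (t * q))) by congr expR; rewrite /q; ring.
rewrite (_ : _ - _ - _ + _ = expR (- ((1 + r) * (t * q))) *
   (expR (r * (1 + r) * (t * p2 s u)) - 1)); last by ring.
apply: has_expectation_eq => w.
rewrite /species_error !addn_eq0 -!mulnb !natrM !occ_eq0_prod !exp_occ.
rewrite -/fe -/se !big_split/= big1_eq mulr1.
by ring.
Qed.

End PairMoments.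
End GoodToulmin.

(** * Inequalities for the exponential *)

Section RealBounds.
Context (R : realType).

(** The two tangents of exp at th * z, evaluated at z and at 0, combine to the
    chord inequality. *)
Lemma expR_le_chord (th z : R) : 0 <= th <= 1 ->
  expR (th * z) <= 1 + th * (expR z - 1).
Proof.
move=> /andP[th0 th1].
have e1 : expR (th * z) * (1 + (1 - th) * z) <= expR z.
  rewrite [leRHS](_ : _ = expR (th * z) * expR ((1 - th) * z)).
    by rewrite ler_pM2l ?expR_gt0// expR_ge1Dx.
  by rewrite -expRD; congr expR; ring.
have e2 : expR (th * z) * (1 + - (th * z)) <= 1.
  rewrite [leRHS](_ : _ = expR (th * z) * expR (- (th * z))).
    by rewrite ler_pM2l ?expR_gt0// expR_ge1Dx.
  by rewrite -expRD subrr expR0.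
have := lerD (ler_wpM2l th0 e1) (ler_wpM2l (_ : 0 <= 1 - th) e2).
rewrite subr_ge0 => /(_ th1); set e := expR (th * z) => h.
lra.
Qed.

Lemma Bernoulli_expR (r x : R) : 0 < r ->
  (1 + r) * (expR (- x) - 1) <= expR (- ((1 + r) * x)) - 1.
Proof.
move=> r0; have r10 : 0 < 1 + r by rewrite addr_gt0.
have th01 : 0 <= (1 + r)^-1 <= 1.
  by rewrite invr_ge0 (ltW r10) invf_le1//= lerDl ltW.
have := expR_le_chord (- ((1 + r) * x)) th01.
rewrite (_ : (1 + r)^-1 * - _ = - x); last by rewrite mulrN mulKf// gt_eqF.
by rewrite -lerBlDl ler_pdivlMl.
Qed.

(** The left-hand side is B times h - z with z = exp (- (1 + r) x), and a chord of
    exp bounds h.  One of the B copies keeps its z, which accounts for the unseen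
    species; in the others Bernoulli's inequality removes it. *)
Lemma arity_bound (B r x : R) : 1 <= B -> 0 < r -> r <= 1 ->
  B * (expR (- ((1 + r) * x)) * (expR (r * (1 + r) * x) - 1)) <=
  (B * r * (r + 1) - r) * (1 - expR (- x)) + (expR (- x) - expR (- ((1 + r) * x))).
Proof.
move=> B1 r0 r1.
rewrite mulrBr mulr1 -expRD.
have -> : - ((1 + r) * x) + r * (1 + r) * x = (1 - r ^+ 2) * - x by ring.
have := Bernoulli_expR x r0.
have : expR ((1 - r ^+ 2) * - x) <= 1 + (1 - r ^+ 2) * (expR (- x) - 1).
  by apply: expR_le_chord; apply/andP; split; nra.
move: (expR (_ * - x)) (expR (- x)) (expR (- (_ * x))) => h y z hy zy.
have hz : h - z <= r * (r + 1) * (1 - y) by lra.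
have := ler_wpM2l (_ : 0 <= B - 1) hz; rewrite subr_ge0 => /(_ B1).
lra.
Qed.

(** After x_u >= c is used in the first factor, the second is convex in c and
    vanishes at c = 0, hence lies below its chord on [0, p]. *)
Lemma pair_bound (r t p q c : R) : 0 < r -> 0 < t -> 0 <= c -> c <= p -> c <= q ->
  p * (expR (- ((1 + r) * (t * (p + q - c)))) * (expR (r * (1 + r) * (t * c)) - 1)) <=
  c * (expR (- ((1 + r) * (t * p))) * (expR (r * (1 + r) * (t * p)) - 1)).
Proof.
move=> r0 t0 c0 cp cq.
have p0 := le_trans c0 cp.
have [p_eq0|pn0] := eqVneq p 0.
  by have c_eq0 : c = 0 by [lra]; rewrite p_eq0 c_eq0 !mul0r.
have K0 : 0 < r * (1 + r) by rewrite mulr_gt0// addr_gt0.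
have th01 : 0 <= c / p <= 1.
  by rewrite divr_ge0//= ler_pdivrMr ?mul1r// lt_neqAle eq_sym pn0.
have := expR_le_chord (r * (1 + r) * (t * p)) th01.
rewrite (_ : c / p * _ = r * (1 + r) * (t * c)); last by field.
rewrite -lerBlDl => chord.
have -> : c * (expR (- ((1 + r) * (t * p))) * (expR (r * (1 + r) * (t * p)) - 1)) =
    p * (expR (- ((1 + r) * (t * p))) * (c / p * (expR (r * (1 + r) * (t * p)) - 1))).
  by field.
rewrite ler_wpM2l// ler_pM ?expR_ge0//.
  by rewrite subr_ge0 -[leLHS]expR0 ler_expR mulr_ge0// ?(ltW K0)// mulr_ge0// ltW.
rewrite ler_expR lerN2 ler_pM2l ?addr_gt0// ler_pM2l//.
by rewrite -addrA lerDl subr_ge0.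
Qed.

End RealBounds.

(** * Bounded arity *)

Section Arity.
Context (R : realType) (S : countType) (B : nat) (mu : probability (sample S) R).
Hypothesis arity : bounded_arity B mu.

Lemma frequency_above_arity : frequency mu (fun A => (B < #|` A|)%N) = 0.
Proof.
rewrite /frequency.
suff -> : mu [set A | (B < #|` A|)%N] = 0%E by [].
(* a countable union of null singletons *)
pose N k : set (sample S) :=
  if (choice.unpickle k : option (sample S)) is Some A
  then [set A' | A' = A /\ (B < #|` A|)%N] else set0.
have -> : [set A : sample S | (B < #|` A|)%N] = \bigcup_k N k.
  apply/seteqP; split => [A BA|A [k _]].
    by exists (choice.pickle A) => //; rewrite /N choice.pickleK.
  by rewrite /N; case: choice.unpickle => // A' [->].
apply/negligibleP; first exact: bigcup_measurable.
apply: negligible_bigcup => k; apply/negligibleP => //.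
rewrite /N; case: choice.unpickle => [A|]; last by rewrite measure0.
have [BA|AB] := ltnP B #|` A|.
  rewrite -(arity BA); congr (mu _).
  by apply/seteqP; split=> A' /= => [[]|].
rewrite -(measure0 mu); congr (mu _).
by apply/seteqP; split=> A' //= -[_].
Qed.

Lemma count_fset_le (F : seq S) (A : {fset S}) : uniq F ->
  \sum_(u <- F) (u \in A)%:R <= #|` A|%:R :> R.
Proof.
move=> uF; rewrite -natr_sum ler_nat.
rewrite (_ : (\sum_(u <- F) (u \in A))%N = size [seq u <- F | u \in A]).
  by apply: uniq_leq_size => [|u]; [exact: filter_uniq|rewrite mem_filter => /andP[]].
by rewrite size_filter -sum1_count [RHS]big_mkcond/=; apply: eq_bigr => u _; case: ifP.
Qed.

(** A sample contains at most B of the species of F, except on a null set; there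
    the trivial bound size F is harmless. *)
Lemma sum_frequency_le (F : seq S) (Q : pred (sample S)) : uniq F ->
  \sum_(u <- F) frequency mu (fun A => Q A && (u \in (A : {fset S})))
   <= B%:R * frequency mu Q.
Proof.
move=> uF.
have H := has_expectation_sum F (fun u : S =>
  has_expectation_frequency mu (fun A => Q A && (u \in (A : {fset S})))).
have := has_expectationD (has_expectationZ B%:R (has_expectation_frequency mu Q))
  (has_expectationZ (size F)%:R
    (has_expectation_frequency mu (fun A => (B < #|` A|)%N))).
rewrite frequency_above_arity mulr0 addr0 => H'.
apply: (has_expectation_le _ H H') => A.
case: (Q A) => /=; last by rewrite big1// mulr0 add0r mulr_ge0.
rewrite mulr1; have [BA|AB] := ltnP B #|` A|.
  rewrite mulr1 -[leLHS]add0r lerD// -natr_sum ler_nat -sum1_size.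
  by apply: leq_sum => u _; rewrite leq_b1.
by rewrite mulr0 addr0 (le_trans (count_fset_le _ uF))// ler_nat.
Qed.

End Arity.

(** * Moment bounds on finitely many species *)

Section FiniteMoments.
Context (R : realType) (S : countType) (B : nat) d (Om : measurableType d)
  (P : probability Om R) (mu : probability (sample S) R) (r t : R)
  (X : nat -> {RV P >-> sample S}) (n m : {RV P >-> nat}).
Hypothesis arity : bounded_arity B mu.
Hypothesis model : poissonized_model mu r t X n m.
Hypotheses (B1 : (1 <= B)%N) (r0 : 0 < r) (r1 : r <= 1) (t0 : 0 < t).

Let fe := first_expedition X n.
Let se := second_expedition X n m.
Let p (s : S) := frequency mu (fun A => s \in (A : {fset S})).

(** The three expectations are explicit exponential sums, and the inequalities
    hold species by species. *)
Lemma finite_moment_bounds (F : seq S) : uniq F ->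
  exists v w1 w2,
  [/\ has_expectation P
        (fun w => (\sum_(s <- F) species_error r (fe w) (se w) s) ^+ 2) v,
      has_expectation P (fun w => \sum_(s <- F) (0 < occ (fe w) s)%N%:R) w1,
      has_expectation P (fun w => \sum_(s <- F)
        ((0 < occ (fe w) s + occ (se w) s)%N%:R - (0 < occ (fe w) s)%N%:R)) w2 &
      [/\ v <= (B%:R * r * (r + 1) - r) * w1 + w2, w2 <= r * w1 & w1 <= B%:R * t]].
Proof.
move=> uF.
pose p2 s u := frequency mu (fun A => (s \in (A : {fset S})) && (u \in (A : {fset S}))).
pose G s u := expR (- ((1 + r) * (t * (p s + p u - p2 s u)))) *
   (expR (r * (1 + r) * (t * p2 s u)) - 1).
pose y s := expR (- (t * p s)); pose z s := expR (- ((1 + r) * (t * p s))).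
exists (\sum_(s <- F) \sum_(u <- F) G s u).
exists (\sum_(s <- F) (1 - y s)), (\sum_(s <- F) (y s - z s)).
have E1 := has_expectation_cst P (1 : R).
have seenE s : has_expectation P (fun w => (0 < occ (fe w) s)%N%:R) (1 - y s).
  apply: has_expectation_eq (has_expectationB E1 (has_expectation_unseen model r0 t0 s)).
  by move=> w /=; rewrite lt0n; case: eqP => _; rewrite ?subrr ?subr0.
have ever s : has_expectation P (fun w => (0 < occ (fe w) s + occ (se w) s)%N%:R) (1 - z s).
  apply: has_expectation_eq (has_expectationB E1 (has_expectation_never_seen model r0 t0 s)).
  by move=> w /=; rewrite lt0n; case: eqP => _; rewrite ?subrr ?subr0.
have pE s : has_expectation mu (fun A : sample S => (s \in (A : {fset S}))%:R) (p s).
  exact: has_expectation_frequency.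
have p2E s u : has_expectation mu
    (fun A : sample S => ((s \in (A : {fset S})) && (u \in (A : {fset S})))%:R) (p2 s u).
  exact: has_expectation_frequency.
have p0 s : 0 <= p s.
  by apply: (has_expectation_le _ (has_expectation_cst mu 0) (pE s)) => A /=.
have p20 s u : 0 <= p2 s u.
  by apply: (has_expectation_le _ (has_expectation_cst mu 0) (p2E s u)) => A /=.
have p2l s u : p2 s u <= p s.
  apply: (has_expectation_le _ (p2E s u) (pE s)) => A /=.
  by rewrite ler_nat; case: (s \in _); case: (u \in _).
have p2r s u : p2 s u <= p u.
  apply: (has_expectation_le _ (p2E s u) (pE u)) => A /=.
  by rewrite ler_nat; case: (s \in _); case: (u \in _).
split.
- have := has_expectation_sum F (fun s => has_expectation_sum F (fun u =>
    has_expectation_pair model r0 r1 t0 s u)).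
  apply: has_expectation_eq => w; rewrite expr2 mulr_suml; apply: eq_bigr => s _.
  by rewrite mulr_sumr.
- exact: has_expectation_sum.
- have := has_expectation_sum F (fun s => has_expectationB (ever s) (seenE s)).
  congr (has_expectation _ _ _); apply: eq_bigr => s _; ring.
split.
- rewrite mulr_sumr -big_split/=; apply: ler_sum => s _.
  pose H := expR (- ((1 + r) * (t * p s))) * (expR (r * (1 + r) * (t * p s)) - 1).
  apply: le_trans (arity_bound (t * p s) _ r0 r1); last by rewrite ler1n.
  rewrite -/H.
  have [ps0|ps0] := eqVneq (p s) 0.
    rewrite big1 => [|u _].
      by rewrite /H ps0 !mulr0 expR0 subrr !mulr0.
    have c0 : p2 s u = 0 by apply/le_anti; rewrite p20 -ps0 p2l.
    by rewrite /G c0 !mulr0 expR0 subrr mulr0.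
  have psgt0 : 0 < p s by rewrite lt_neqAle eq_sym ps0 p0.
  rewrite -(ler_pM2l psgt0) mulr_sumr mulrCA mulrA.
  apply: (@le_trans _ _ (\sum_(u <- F) p2 s u * H)).
    by apply: ler_sum => u _; exact: pair_bound.
  rewrite -mulr_suml ler_wpM2r//.
    rewrite /H mulr_ge0 ?expR_ge0// subr_ge0 -[leLHS]expR0 ler_expR.
    by rewrite !mulr_ge0// ?addr_ge0// ltW.
  exact: sum_frequency_le.
- rewrite mulr_sumr; apply: ler_sum => s _.
  have := Bernoulli_expR (t * p s) r0; rewrite -/(y s) -/(z s); lra.
- apply: (@le_trans _ _ (\sum_(s <- F) t * p s)).
    apply: ler_sum => s _; rewrite lerBlDr -lerBlDl.
    by have := expR_ge1Dx (- (t * p s)); rewrite -/(y s).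
  rewrite -mulr_sumr mulrC ler_wpM2r ?(ltW t0)//.
  have := sum_frequency_le arity (fun=> true) uF.
  have -> : frequency mu (fun=> true) = 1.
    apply: has_expectation_unique (has_expectation_frequency mu (fun=> true)) _.
    exact: has_expectation_cst.
  by rewrite mulr1.
Qed.

End FiniteMoments.

(** * Exhausting the species *)

Section Exhaustion.

(** A form of Fatou's lemma for functions that are stationary at each point, as
    sums over increasing finite sets of species are. *)
Lemma le_integral_eventually d (T : measurableType d) (R : realType)
    (P : probability T R) (H_ : nat -> T -> R) (H : T -> R) (c : \bar R) :
  (forall k, measurable_fun setT (H_ k)) -> (forall k x, 0 <= H_ k x) ->
  (forall x, \forall k \near \oo, H_ k x = H x) ->
  (forall k, (\int[P]_x (H_ k x)%:E <= c)%E) -> (\int[P]_x (H x)%:E <= c)%E.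
Proof.
move=> mH H0 HH Hc.
have HE x : limn_einf (fun k => (H_ k x)%:E) = (H x)%:E.
  have HcvgE : (fun k => (H_ k x)%:E) @ \oo --> (H x)%:E.
    by apply: cvg_near_cst; apply: filterS (HH x) => k ->.
  rewrite is_cvg_limn_einfE; first exact: cvg_lim.
  by apply/cvg_ex; exists (H x)%:E.
under eq_integral do rewrite -HE.
apply: (le_trans (fatou _ _ _ _)) => //.
- by move=> k; exact/measurable_EFinP.
- by move=> k x _; rewrite lee_fin.
rewrite limn_einf_lim; apply: lime_le; first exact: is_cvg_einfs.
apply: nearW => k; apply: le_trans (Hc k).
by apply: ereal_inf_lbound; exists k => /=.
Qed.

(** Species with a code below k: every finite set of species is eventually
    contained in these. *)
Definition species_upto (S : countType) (k : nat) : seq S :=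
  undup (pmap choice.unpickle (iota 0 k)).

Lemma species_upto_uniq (S : countType) k : uniq (species_upto S k).
Proof. exact: undup_uniq. Qed.

Lemma near_species_upto (S : countType) (U : seq S) :
  \forall k \near \oo, {subset U <= species_upto S k}.
Proof.
exists (\max_(s <- U) (choice.pickle s).+1)%N => // k /= Uk s sU.
rewrite mem_undup mem_pmap; apply/mapP; exists (choice.pickle s).
  rewrite mem_iota/= add0n; apply: leq_trans Uk.
  exact: (@leq_bigmax_seq _ U xpredT (fun s => (choice.pickle s).+1) s sU).
by rewrite choice.pickleK.
Qed.

End Exhaustion.

(** * Numbers of species as finite sums *)

Section Counting.
Context (S : countType).

(** All cardinals of sets of species below are counted along one finite
    duplicate-free sequence that contains the observed species. *)
Lemma card_fset_set_count (F : seq S) (Q : pred S) : uniq F -> (forall s, Q s -> s \in F) ->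
  #|` fset_set [set s | Q s]| = count Q F.
Proof.
move=> uF QF.
have -> : [set s | Q s] = [set` [fset s in [seq s <- F | Q s]]%fset].
  apply/seteqP; split=> s /=; rewrite !inE mem_filter.
    by move=> Qs; rewrite Qs QF.
  by move=> /andP[].
by rewrite set_fsetK card_fseq undup_id ?filter_uniq// size_filter.
Qed.

Definition observed_species (D : seq (sample S)) : seq S :=
  flatten [seq enum_fset (A : {fset S}) | A <- D].

Lemma occ_gt0 (D : seq (sample S)) s : (0 < occ D s)%N = (s \in observed_species D).
Proof.
rewrite /occ -has_count; apply/hasP/flatten_mapP => -[A AD sA]; exists A => //.
Qed.

Lemma occ_cat (D D' : seq (sample S)) s : occ (D ++ D') s = (occ D s + occ D' s)%N.
Proof. exact: count_cat. Qed.

Variables (R : realType) (F : seq S) (D : seq (sample S)).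
Hypothesis uF : uniq F.

Lemma nseen_sum : {subset observed_species D <= F} ->
  (nseen D)%:R = \sum_(s <- F) (0 < occ D s)%N%:R :> R.
Proof.
move=> DF; rewrite /nseen (card_fset_set_count uF) => [|s]; last by rewrite occ_gt0 => /DF.
by rewrite -sum1_count natr_sum big_mkcond/=; apply: eq_bigr => s _; case: ifP.
Qed.

Lemma nunseen_sum (D' : seq (sample S)) : {subset observed_species (D ++ D') <= F} ->
  nunseen R D D' = \sum_(s <- F) ((0 < occ D s + occ D' s)%N%:R - (0 < occ D s)%N%:R).
Proof.
move=> DF; rewrite sumrB /nunseen; congr (_ - _).
  rewrite /nseen2 (card_fset_set_count uF) => [|s].
    by rewrite -sum1_count natr_sum big_mkcond/=; apply: eq_bigr => s _; case: ifP.
  by rewrite -occ_cat occ_gt0 => /DF.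
apply: nseen_sum => s sD; apply: DF.
by rewrite -occ_gt0 occ_cat ltn_addr// occ_gt0.
Qed.

Lemma good_toulmin_sum (r t : R) : {subset observed_species D <= F} ->
  good_toulmin r t D = - \sum_(s <- F) (0 < occ D s)%N%:R * (- r) ^+ occ D s.
Proof.
move=> DF; rewrite /good_toulmin; congr (- _).
rewrite (fsbigE F)//; first by apply: eq_bigl => s; exact: in_setT.
move=> s _; case: (posnP (occ D s)) => [->|sD]; first by rewrite mul0r.
by rewrite DF// -occ_gt0.
Qed.

(** On a seen species the error is (- r)^N, on a newly found one it is
    1 = (- r)^0 - 0, and on one that is never seen it is (- r)^0 - 1 = 0. *)
Lemma good_toulmin_error (r t : R) (D' : seq (sample S)) :
  {subset observed_species (D ++ D') <= F} ->
  nunseen R D D' - good_toulmin r t D = \sum_(s <- F) species_error r D D' s.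
Proof.
move=> DF; rewrite nunseen_sum// good_toulmin_sum => [|s sD]; last first.
  by apply: DF; rewrite -occ_gt0 occ_cat ltn_addr// occ_gt0.
rewrite opprK -big_split/=; apply: eq_bigr => s _; rewrite /species_error.
case: (occ D s) => [|k]; last by rewrite addSn/= mul1r subrr add0r subr0.
by rewrite add0n/= subr0 mul0r addr0 expr0 lt0n; case: eqP => _; rewrite ?subrr ?subr0.
Qed.

End Counting.

Lemma ler_sum_subset (R : numDomainType) (S : eqType) (F F' : seq S) (f : S -> R) :
  uniq F -> uniq F' -> {subset F <= F'} -> (forall s, 0 <= f s) ->
  \sum_(s <- F) f s <= \sum_(s <- F') f s.
Proof.
move=> uF uF' FF' f0.
have -> : \sum_(s <- F) f s = \sum_(s <- F' | s \in F) f s.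
  rewrite -[RHS]big_filter; apply: perm_big; apply: uniq_perm => //.
    exact: filter_uniq.
  by move=> s; rewrite mem_filter; case: (boolP (s \in F)) => // /FF' ->.
rewrite [leRHS](bigID (mem F))/= lerDl; exact: sumr_ge0.
Qed.

Section PartialCounts.
Context (R : realType) (S : countType).
Implicit Types (F : seq S) (D : seq (sample S)).

Lemma partial_nseen_le F D : uniq F ->
  \sum_(s <- F) (0 < occ D s)%N%:R <= (nseen D)%:R :> R.
Proof.
move=> uF; rewrite (@nseen_sum _ R (undup (observed_species D ++ F))) ?undup_uniq//.
  apply: ler_sum_subset => //; first exact: undup_uniq.
  by move=> s sF; rewrite mem_undup mem_cat sF orbT.
by move=> s sD; rewrite mem_undup mem_cat sD.
Qed.

Lemma unseen_term_ge0 (D D' : seq (sample S)) s :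
  0 <= (0 < occ D s + occ D' s)%N%:R - (0 < occ D s)%N%:R :> R.
Proof. by rewrite subr_ge0 ler_nat; case: (occ D s) => //; rewrite ltnn. Qed.

Lemma partial_nunseen_le F D D' : uniq F ->
  \sum_(s <- F) ((0 < occ D s + occ D' s)%N%:R - (0 < occ D s)%N%:R)
  <= nunseen R D D'.
Proof.
move=> uF; rewrite (@nunseen_sum _ R (undup (observed_species (D ++ D') ++ F))) ?undup_uniq//.
  apply: ler_sum_subset => //; first exact: undup_uniq.
    by move=> s sF; rewrite mem_undup mem_cat sF orbT.
  by move=> s; exact: unseen_term_ge0.
by move=> s sD; rewrite mem_undup mem_cat sD.
Qed.

Lemma nunseen_ge0 D D' : 0 <= nunseen R D D'.
Proof. by have := @partial_nunseen_le [::] D D' isT; rewrite big_nil. Qed.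

End PartialCounts.

(** * Upper bound for the Good-Toulmin estimator *)

Section UpperBound.
Context (R : realType) (S : countType) (B : nat) d (Om : measurableType d)
  (P : probability Om R) (mu : probability (sample S) R) (r t : R)
  (X : nat -> {RV P >-> sample S}) (n m : {RV P >-> nat}).
Hypothesis arity : bounded_arity B mu.
Hypothesis model : poissonized_model mu r t X n m.
Hypotheses (B1 : (1 <= B)%N) (r0 : 0 < r) (r1 : r <= 1) (t0 : 0 < t).

Let fe := first_expedition X n.
Let se := second_expedition X n m.
Let F := species_upto S.

Lemma measurable_expeditions (h : seq (sample S) -> seq (sample S) -> R) :
  measurable_fun setT (fun w => h (fe w) (se w)).
Proof.
apply: (measurable_obs (L := X) (n := n) (m := m)).
- by move=> k; exact: (measurable_funPTI n (_ : measurable [set k])).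
- by move=> k; exact: (measurable_funPTI m (_ : measurable [set k])).
- by move=> i x; exact: (measurable_funPTI (X i) (_ : measurable [set x])).
Qed.

Let near_eq (w : Om) (f : seq S -> R) (c : R) :
  (forall F, uniq F -> {subset observed_species (fe w ++ se w) <= F} -> c = f F) ->
  \forall k \near \oo, f (F k) = c.
Proof.
move=> fc; apply: filterS (near_species_upto (observed_species (fe w ++ se w))) => k Fk.
by rewrite -fc// species_upto_uniq.
Qed.

Lemma mean_seen_le : (mean_seen X n <= (B%:R * t)%:E)%E.
Proof.
rewrite /mean_seen unlock.
apply: (@le_integral_eventually _ _ _ P
  (fun k w => \sum_(s <- F k) (0 < occ (fe w) s)%N%:R)).
- by move=> k; exact: (measurable_expeditions (fun D _ => \sum_(s <- F k) (0 < occ D s)%N%:R)).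
- by move=> k w; exact: sumr_ge0.
- move=> w; apply: (near_eq (w := w)
    (f := fun F => \sum_(s <- F) (0 < occ (fe w) s)%N%:R)) => F' uF' F'D.
  apply: nseen_sum => // s sD.
  by apply: F'D; rewrite -occ_gt0 occ_cat ltn_addr// occ_gt0.
- move=> k; have [v [w1 [w2 [_ [_ E1] _ [_ _ w1B]]]]] :=
    finite_moment_bounds arity model B1 r0 r1 t0 (species_upto_uniq S k).
  by rewrite E1 lee_fin.
Qed.

Lemma mean_seen_ge k w1 :
  has_expectation P (fun w => \sum_(s <- F k) (0 < occ (fe w) s)%N%:R) w1 ->
  (w1%:E <= mean_seen X n)%E.
Proof.
move=> H; rewrite /mean_seen unlock.
apply: (has_expectation_le_integral _ _ _ H) => // [|w].
  exact: (measurable_expeditions (fun D _ => (nseen D)%:R)).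
exact/partial_nseen_le/species_upto_uniq.
Qed.

Lemma mean_unseen_ge k w2 :
  has_expectation P (fun w => \sum_(s <- F k)
    ((0 < occ (fe w) s + occ (se w) s)%N%:R - (0 < occ (fe w) s)%N%:R)) w2 ->
  (w2%:E <= mean_unseen X n m)%E.
Proof.
move=> H; rewrite /mean_unseen unlock.
apply: (has_expectation_le_integral _ _ _ H) => [|w|w].
- exact: (measurable_expeditions (nunseen R (S := S))).
- exact/partial_nunseen_le/species_upto_uniq.
- exact: nunseen_ge0.
Qed.

(** The mean number of new species is at most r times that of seen ones: by
    Bernoulli's inequality this holds for each species. *)
Lemma mean_unseen_le : (mean_unseen X n m <= r%:E * mean_seen X n)%E.
Proof.
rewrite {1}/mean_unseen unlock.
apply: (@le_integral_eventually _ _ _ P (fun k w => \sum_(s <- F k)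
    ((0 < occ (fe w) s + occ (se w) s)%N%:R - (0 < occ (fe w) s)%N%:R))).
- move=> k; exact: (measurable_expeditions (fun D D' => \sum_(s <- F k)
    ((0 < occ D s + occ D' s)%N%:R - (0 < occ D s)%N%:R))).
- by move=> k w; apply: sumr_ge0 => s _; exact: unseen_term_ge0.
- move=> w; apply: (near_eq (w := w) (f := fun F => \sum_(s <- F)
    ((0 < occ (fe w) s + occ (se w) s)%N%:R - (0 < occ (fe w) s)%N%:R))) => F' uF' F'D.
  exact: nunseen_sum.
- move=> k; have [v [w1 [w2 [_ E1 [_ E2] [_ w21 _]]]]] :=
    finite_moment_bounds arity model B1 r0 r1 t0 (species_upto_uniq S k).
  rewrite E2; apply: (@le_trans _ _ (r%:E * w1%:E)%E); first by rewrite -EFinM lee_fin.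
  by rewrite lee_wpmul2l ?lee_fin ?(ltW r0)//; exact: mean_seen_ge E1.
Qed.

Let C1_ge0 : 0 <= B%:R * r * (r + 1) - r.
Proof.
have B10 : 0 <= B%:R - 1 :> R by rewrite subr_ge0 ler1n.
have := mulr_ge0 B10 (mulr_ge0 (ltW r0) (addr_ge0 (ltW r0) ler01)).
have := sqr_ge0 r; lra.
Qed.

Lemma good_toulmin_mse_le : (mse r t X n m (@good_toulmin R) <=
  (B%:R * r * (r + 1) - r)%:E * mean_seen X n + mean_unseen X n m)%E.
Proof.
rewrite {1}/mse unlock.
apply: (@le_integral_eventually _ _ _ P (fun k w =>
  (\sum_(s <- F k) species_error r (fe w) (se w) s) ^+ 2)).
- move=> k; exact: (measurable_expeditions (fun D D' =>
    (\sum_(s <- F k) species_error r D D' s) ^+ 2)).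
- by move=> k w; exact: sqr_ge0.
- move=> w; apply: (near_eq (w := w) (f := fun F => (\sum_(s <- F) _) ^+ 2)) => F' uF' F'D.
  by rewrite real_normK ?num_real//; congr (_ ^+ 2); exact: good_toulmin_error.
- move=> k; have [v [w1 [w2 [[_ Ev] E1 E2 [vw _ _]]]]] :=
    finite_moment_bounds arity model B1 r0 r1 t0 (species_upto_uniq S k).
  rewrite Ev; apply: (@le_trans _ _ ((B%:R * r * (r + 1) - r)%:E * w1%:E + w2%:E)%E).
    by rewrite -EFinM -EFinD lee_fin.
  apply: leeD; last exact: mean_unseen_ge E2.
  by rewrite lee_wpmul2l ?lee_fin//; exact: mean_seen_ge E1.
Qed.

Lemma mean_counts_le :
  ((B%:R * r * (r + 1) - r)%:E * mean_seen X n + mean_unseen X n m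
   <= (B%:R ^+ 2 * r * (r + 1) * t)%:E)%E.
Proof.
have := mean_seen_le; have := mean_unseen_le.
have : (0 <= mean_seen X n)%E by rewrite /mean_seen unlock integral_ge0// => w _; rewrite lee_fin.
case: (mean_seen X n) => [a a0|//|//]; rewrite lee_fin in a0 *.
move=> ub aB; apply: (@le_trans _ _ ((B%:R * r * (r + 1) - r)%:E * a%:E + r%:E * a%:E)%E).
  exact: leeD2l.
rewrite -!EFinM -EFinD lee_fin.
have Br : 0 <= B%:R * r * (r + 1) by rewrite !mulr_ge0// ?addr_ge0// ltW.
have := ler_wpM2l Br aB; lra.
Qed.

End UpperBound.

(** * Digits of a uniform real number *)

Section Digits.
Context (R : realType) (M : nat).
Let Q := M.+1.

(** The digits after the point in base Q = M + 1, numbered from 0: digit 0 has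
    weight 1 / Q. *)
Definition digit (i : nat) (x : R) : 'I_M.+1 := inord (Num.truncn (x * Q%:R ^+ i.+1) %% Q).

Definition digit_cell (p N : nat) (x : R) : bool := (0 <= x) && (Num.truncn (x * Q%:R ^+ p) == N).

Let Q0 : 0 < Q%:R :> R. Proof. by rewrite ltr0n. Qed.

Lemma truncn_divn (x : R) : 0 <= x -> Num.truncn x = (Num.truncn (x * Q%:R) %/ Q)%N.
Proof.
move=> x0; have xQ0 : 0 <= x * Q%:R by rewrite mulr_ge0// ltW.
apply/eqP; rewrite truncn_eq//.
have /andP[l u] := truncn_itv xQ0.
set T := Num.truncn _ in l u *.
apply/andP; split.
  rewrite -(ler_pM2r Q0) (le_trans _ l)// -natrM ler_nat; exact: leq_divM.
rewrite -(ltr_pM2r Q0) (lt_le_trans u)// -natrM ler_nat.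
by rewrite -ltn_divLR.
Qed.

(** A cell of level p is the disjoint union of Q cells of level p + 1, on each of
    which the digit of level p is constant. *)
Lemma cell_split p N x (F : 'I_M.+1 -> R) :
  (digit_cell p N x)%:R * F (digit p x) =
  \sum_(j < M.+1) (digit_cell p.+1 (N * Q + j) x)%:R * F j.
Proof.
rewrite /digit_cell; have [x0|x0] := leP 0 x; last first.
  by rewrite mul0r big1// => j _; rewrite mul0r.
have y0 : 0 <= x * Q%:R ^+ p by rewrite mulr_ge0// exprn_ge0// ltW.
rewrite /= (truncn_divn y0) -mulrA -exprSr /digit.
set T := Num.truncn _.
rewrite (bigD1 (inord (T %% Q)))//= big1 => [|j jT].
  rewrite addr0 inordK ?ltn_pmod//; congr (_%:R * _); congr nat_of_bool.
  apply/eqP/eqP => [<-|TE]; first exact: divn_eq.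
  by rewrite TE divnMDl// divn_small ?addn0// ltn_pmod.
case: eqP => [TE|]; last by rewrite mul0r.
move/eqP: jT; case; apply/val_inj => /=.
by rewrite inordK ?ltn_pmod// TE modnMDl modn_small.
Qed.

Let U : probability (measurableTypeR R) R := uniform_prob (@ltr01 R).

Lemma measurable_truncn_eq (c : R) k :
  measurable [set x : measurableTypeR R | Num.truncn (x * c) = k].
Proof.
pose b (x : measurableTypeR R) := (x * c < k.+1%:R) && ((k == 0%N) || (k%:R <= x * c)).
have mb : measurable_fun setT b.
  have mxc : measurable_fun setT (fun x : measurableTypeR R => x * c).
    exact: measurable_funM.
  apply: measurable_and; first exact: measurable_fun_ltr.
  by apply: measurable_or => //; exact: measurable_fun_ler.
rewrite (_ : [set x | _] = b @^-1` [set true]).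
  by rewrite -[X in measurable X]setTI; exact: mb.
have neg0 y : y < 0 :> R -> Num.truncn y = 0%N.
  by move=> y0; apply/truncn0Pn; rewrite -ltNge (lt_trans y0).
apply/seteqP; split => x /=; rewrite /b; have [y0|y0] := leP 0 (x * c).
- by move/eqP; rewrite truncn_eq// => /andP[-> ->]; rewrite orbT.
- rewrite neg0// => <-.
  by rewrite (lt_trans y0).
- case/andP=> ub lb; apply/eqP; rewrite truncn_eq// ub andbT.
  by case/orP: lb => // /eqP ->.
- case/andP=> _ /orP[/eqP ->|kx]; first by rewrite neg0.
  by have := le_lt_trans kx y0; rewrite ltrn0.
Qed.

Lemma measurable_digit i j : measurable [set x : measurableTypeR R | digit i x = j].
Proof.
apply: (measurable_preimage_countable
  (Y := fun x : measurableTypeR R => Num.truncn (x * Q%:R ^+ i.+1)) _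
  [set T | inord (T %% Q) = j]).
by move=> k; exact: measurable_truncn_eq.
Qed.

Lemma uniform_digit_cell p N : (N < Q ^ p)%N ->
  has_expectation U (fun x => (digit_cell p N x)%:R) (Q%:R ^- p).
Proof.
move=> Np; have Qp0 : 0 < Q%:R ^+ p :> R by rewrite exprn_gt0.
pose I : set (measurableTypeR R) := `[N%:R / Q%:R ^+ p, N.+1%:R / Q%:R ^+ p[%classic.
have cellE x : digit_cell p N x = (x \in I).
  rewrite /digit_cell /I; apply/andP/idP => [[x0]|].
    rewrite truncn_eq => [lu|]; last by rewrite mulr_ge0// ltW.
    by rewrite inE/= in_itv/= ler_pdivrMr// ltr_pdivlMr.
  rewrite inE/= in_itv/= ler_pdivrMr// ltr_pdivlMr// => lu.
  have x0 : 0 <= x.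
    by move: lu => /andP[l _]; rewrite -(pmulr_lge0 _ Qp0) (le_trans _ l).
  by rewrite x0; split => //; rewrite truncn_eq// mulr_ge0// ltW.
apply: (@has_expectation_eq _ _ _ _ \1_I); first by move=> x; rewrite cellE.
apply: has_expectation_indic; first exact: measurable_itv.
have -> : U I = (\int[lebesgue_measure]_(x in I) (uniform_pdf 0 1 x)%:E)%E by [].
rewrite (eq_integral (cst 1%E)) => [|x].
  rewrite integral_cst//=; last exact: measurable_itv.
  rewrite mul1e lebesgue_measure_itv/= lte_fin.
  rewrite ltr_pM2r ?invr_gt0// ltr_nat ltnSn -EFinD; congr EFin.
  by rewrite -mulrBl -natrB// subSnn mul1r.
rewrite inE /I/= in_itv/= => /andP[l u]; rewrite /uniform_pdf subr0 invr1.
rewrite (le_trans _ l) ?divr_ge0//= (le_trans (ltW u))//.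
by rewrite ler_pdivrMr// mul1r -natrX ler_nat.
Qed.

(** Induction on the number of digits, over all cells at once: the first digit
    selects a subcell, in which the remaining digits start one level deeper. *)
Lemma digits_independent k p N (f : nat -> 'I_M.+1 -> R) : (N < Q ^ p)%N ->
  has_expectation U
    (fun x => (digit_cell p N x)%:R * \prod_(i < k) f i (digit (p + i) x))
    (Q%:R ^- p * \prod_(i < k) ((\sum_j f i j) / Q%:R)).
Proof.
elim: k p N f => [|k IHk] p N f Np.
  rewrite big_ord0 mulr1; apply: has_expectation_eq (uniform_digit_cell Np) => x.
  by rewrite big_ord0 mulr1.
have Npj (j : 'I_M.+1) : (N * Q + j < Q ^ p.+1)%N.
  rewrite expnS mulnC (leq_trans (_ : _ < Q * N.+1)%N)//.
    by rewrite mulnS addnC ltn_add2r.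
  by rewrite leq_mul2l orbC Np.
have := has_expectation_sum (index_enum 'I_M.+1) (fun j => has_expectationZ (f 0%N j)
   (IHk p.+1 (N * Q + j)%N (fun i => f i.+1) (Npj j))).
rewrite -mulr_suml [X in has_expectation _ _ X](_ : _ =
    Q%:R ^- p * \prod_(i < k.+1) ((\sum_j f i j) / Q%:R)); last first.
  rewrite big_ord_recl/= exprSr invfM; ring.
apply: has_expectation_eq => x.
rewrite big_ord_recl/= addn0 mulrCA mulrA.
rewrite [X in X * _]mulrC cell_split mulr_suml; apply: eq_bigr => j _.
rewrite mulrCA mulrA; congr (_ * _); apply: eq_bigr => i _.
by rewrite addnS addSn.
Qed.

End Digits.

Section DigitLaw.
Context (R : realType) (M : nat).
Let Q := M.+1.
Let U : probability (measurableTypeR R) R := uniform_prob (@ltr01 R).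

(** The points outside the cell [0, 1[, where the digits have no meaning, form a
    null set, so that the restriction to this cell can be dropped. *)
Lemma has_expectation_digits k (f : nat -> 'I_M.+1 -> R) :
  (forall i j, `|f i j| <= 1) ->
  has_expectation U (fun x => \prod_(i < k) f i (digit M i x))
    (\prod_(i < k) ((\sum_j f i j) / Q%:R)).
Proof.
move=> f1.
pose F := fun x : measurableTypeR R => \prod_(i < k) f i (digit M i x).
pose c : R -> bool := digit_cell M 0 0.
have cF : has_expectation U (fun x => (c x)%:R * F x)
    (\prod_(i < k) ((\sum_j f i j) / Q%:R)).
  have := @digits_independent R M k 0 0 f isT.
  by rewrite expr0 invr1 mul1r.
have c1 : has_expectation U (fun x => (c x)%:R) 1.
  by have := @uniform_digit_cell R M 0 0 isT; rewrite expr0 invr1.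
have mF : measurable_fun setT F.
  apply: measurable_prod => i _.
  exact: (measurable_comp_countable (f i) (@measurable_digit R M i)).
have [v Fv] : exists v, has_expectation U F v.
  by apply: bounded_has_expectation mF _ => x; exact: norm_prod_le1.
have le1 x : `|F x - (c x)%:R * F x| <= 1 - (c x)%:R.
  case: (c x); first by rewrite mul1r !subrr normr0.
  by rewrite mul0r !subr0 norm_prod_le1.
have diff := has_expectationB Fv cF.
have zero := has_expectationB (has_expectation_cst U 1) c1.
rewrite subrr in zero.
suff vE : v - \prod_(i < k) ((\sum_j f i j) / Q%:R) = 0 by rewrite -(subr0_eq vE).
apply/le_anti/andP; split.
  by apply: (has_expectation_le _ diff zero) => x; exact: le_trans (ler_norm _) (le1 x).
have zeroN := has_expectationZ (-1) zero; rewrite mulr0 in zeroN.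
apply: (has_expectation_le _ zeroN diff) => x.
by rewrite mulN1r lerNl (le_trans _ (le1 x))// -normrN ler_norm.
Qed.

Lemma digit_event k (D : nat -> set 'I_M.+1) :
  U [set x | forall i, (i < k)%N -> D i (digit M i x)] =
  (\prod_(i < k) ((\sum_j (j \in D i)%:R) / Q%:R))%:E.
Proof.
have f1 i j : `|(j \in D i)%:R : R| <= 1 by rewrite normr_nat lern1 leq_b1.
have [_ <-] := has_expectation_digits k f1.
rewrite -[X in U X]setIT -integral_indic//; last first.
  rewrite (_ : [set x | _] = \bigcap_(i in `I_k) (fun x => digit M i x) @^-1` D i)//.
  apply: fin_bigcap_measurable => // i _.
  exact: (measurable_preimage_countable (@measurable_digit R M i)).
apply: eq_integral => x _; congr EFin; rewrite indicE.
have [xE|xE] := boolP (x \in _).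
  by rewrite big1// => i _; rewrite mem_set//; exact: (set_mem xE).
have [i iD] : exists i : 'I_k, digit M i x \notin D i.
  apply: contrapT => H; move/negP: xE; apply; apply/mem_set => i ik.
  apply: contrapT => Di; apply: H; exists (Ordinal ik).
  by apply/negP => /set_mem.
by rewrite (bigD1 i)//= (negbTE iD) mul0r.
Qed.

Lemma digit_event1 i (D : set 'I_M.+1) :
  U [set x | D (digit M i x)] = ((\sum_j (j \in D)%:R) / Q%:R)%:E.
Proof.
have := digit_event i.+1 (fun i' => if i' == i then D else setT).
rewrite (_ : [set x | _] = [set x | D (digit M i x)]); last first.
  apply/seteqP; split=> x /=; first by move=> /(_ i (ltnSn i)); rewrite eqxx.
  by move=> Dx i' _; case: eqP => // ->.
move=> ->; rewrite big_ord_recr/= eqxx big1 ?mul1r// => i' _.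
have -> : (nat_of_ord i' == i) = false by rewrite ltn_eqF.
rewrite (eq_bigr (fun=> 1)) => [|j _]; last by rewrite in_setT.
by rewrite sumr_const card_ord divff// pnatr_eq0.
Qed.

End DigitLaw.

(** * A model with uniform draws *)

Section Realization.
Context (R : realType) (M : nat) (S : countType) (x : 'I_M.+1 -> sample S) (a b : R).
Hypotheses (a0 : 0 < a) (b0 : 0 < b).
Let Q := M.+1.

Let U : probability (measurableTypeR R) R := uniform_prob (@ltr01 R).
Let Pa : probability nat R := poisson_prob a 0.
Let Pb : probability nat R := poisson_prob b 0.

Definition sample_space : measurableType _ := ((nat * nat) * measurableTypeR R)%type.
Definition sample_law : probability sample_space R := ((Pa \x Pb) \x U)%E.

Definition first_size (w : sample_space) : nat := w.1.1.
Definition second_size (w : sample_space) : nat := w.1.2.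
Definition label (i : nat) (w : sample_space) : 'I_M.+1 := digit M i w.2.
Definition draw (i : nat) (w : sample_space) : sample S := x (label i w).

Lemma sample_law_rect (A C : set nat) (E : set (measurableTypeR R)) : measurable E ->
  sample_law ((A `*` C) `*` E) = (Pa A * Pb C * U E)%E.
Proof.
move=> mE; transitivity ((Pa \x Pb)%E (A `*` C) * U E)%E.
  by apply: product_measure1E => //; exact: measurableX.
by congr (_ * _)%E; exact: product_measure1E.
Qed.

Lemma poisson_probE (c : R) (k : nat) : 0 < c ->
  poisson_prob c 0 [set k] = (poisson_pmf c k)%:E.
Proof.
by move=> c0; rewrite /poisson_prob c0 esum_set1// lee_fin poisson_pmf_ge0.
Qed.

Lemma measurable_first_size : measurable_fun setT first_size.
Proof. by apply: measurableT_comp => //; exact: measurable_fst. Qed.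

Lemma measurable_second_size : measurable_fun setT second_size.
Proof. by apply: measurableT_comp => //; exact: measurable_snd. Qed.

Lemma measurable_label i j : measurable [set w | label i w = j].
Proof.
rewrite (_ : [set w | _] = setT `*` [set y | digit M i y = j]).
  by apply: measurableX => //; exact: measurable_digit.
by apply/seteqP; split=> w //= [].
Qed.

Lemma measurable_draw i : measurable_fun setT (draw i).
Proof.
move=> _ A _; rewrite setTI.
exact: (measurable_preimage_countable (measurable_label i) (x @^-1` A)).
Qed.

HB.instance Definition _ := isMeasurableFun.Build _ _ _ _ first_size measurable_first_size.
HB.instance Definition _ := isMeasurableFun.Build _ _ _ _ second_size measurable_second_size.
HB.instance Definition _ i := isMeasurableFun.Build _ _ _ _ (draw i) (measurable_draw i).

Let X (i : nat) : {RV sample_law >-> sample S} := draw i.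
Let n : {RV sample_law >-> nat} := first_size.
Let m : {RV sample_law >-> nat} := second_size.

Definition uniform_sample_law : probability (sample S) R := distribution sample_law (X 0%N).

Lemma label_event (A C : set nat) k (D : nat -> set 'I_M.+1) :
  sample_law [set w | [/\ A (first_size w), C (second_size w) &
    forall i, (i < k)%N -> D i (label i w)]] =
  (Pa A * Pb C * (\prod_(i < k) ((\sum_j (j \in D i)%:R) / Q%:R))%:E)%E.
Proof.
rewrite -digit_event -sample_law_rect; last first.
  rewrite (_ : [set y | _] = \bigcap_(i in `I_k) (digit M i : measurableTypeR R -> _) @^-1` D i)//.
  apply: fin_bigcap_measurable => // i _.
  exact: (measurable_preimage_countable (@measurable_digit R M i)).
by congr (sample_law _); apply/seteqP; split=> w /= => [[]|[[]]].
Qed.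

Let first_sizeE (A : set nat) : sample_law (n @^-1` A) = Pa A.
Proof.
have := label_event A setT 0 (fun=> setT); rewrite big_ord0 probability_setT !mule1 => <-.
by congr (sample_law _); apply/seteqP; split=> w //= [].
Qed.

Let second_sizeE (C : set nat) : sample_law (m @^-1` C) = Pb C.
Proof.
have := label_event setT C 0 (fun=> setT); rewrite big_ord0 probability_setT mule1 mul1e => <-.
by congr (sample_law _); apply/seteqP; split=> w //= [].
Qed.

Let drawE i (D : set (sample S)) :
  sample_law (X i @^-1` D) = ((\sum_j (j \in x @^-1` D)%:R) / Q%:R)%:E.
Proof.
rewrite -(digit_event1 _ i) -[RHS]mul1e -[X in (X * _)%E]mul1e.
rewrite -{1}(probability_setT Pa) -(probability_setT Pb) -sample_law_rect.
  by congr (sample_law _); apply/seteqP; split=> w //= [].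
exact: (measurable_preimage_countable (@measurable_digit R M i)).
Qed.

Lemma uniform_poisson_labels :
  poisson_labels sample_law a b (fun=> Q%:R^-1) first_size second_size label.
Proof.
split.
- by move=> k; exact: (measurable_funPTI n (_ : measurable [set k])).
- by move=> k; exact: (measurable_funPTI m (_ : measurable [set k])).
- exact: measurable_label.
move=> K k l c.
pose D i : set 'I_M.+1 := if insub i is Some i' then [set c i'] else setT.
have DE (i : 'I_K) : D i = [set c i] by rewrite /D valK.
transitivity (Pa [set k] * Pb [set l] *
    (\prod_(i < K) ((\sum_j (j \in D i)%:R) / Q%:R))%:E)%E; last first.
  rewrite 2!EFinM -(poisson_probE k a0) -(poisson_probE l b0); congr (_ * _%:E)%E.
  apply: eq_bigr => i _; rewrite DE (bigD1 (c i))//= big1 => [|j jc].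
    by rewrite mem_set// addr0 mul1r.
  by rewrite memNset// => /eqP; rewrite (negbTE jc).
rewrite -label_event; congr (sample_law _).
apply/seteqP; split=> w /= [-> ->] Lc; split => //.
- by move=> i iK; have := Lc (Ordinal iK); rewrite -[X in D X]/(val (Ordinal iK)) DE.
- by move=> i; have := Lc i (ltn_ord i); rewrite DE.
Qed.

Lemma uniform_poissonized_model (r : R) : b = r * a ->
  poissonized_model uniform_sample_law r a X n m.
Proof.
move=> bE; split.
- by move=> i A; rewrite /uniform_sample_law /distribution/= /pushforward !drawE.
- by move=> k; apply: etrans (first_sizeE _) _; exact: poisson_probE.
- by move=> k; apply: etrans (second_sizeE _) _; rewrite -bE; exact: poisson_probE.
move=> k A C D; rewrite first_sizeE second_sizeE.
under eq_bigr do rewrite drawE.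
rewrite prodEFin -(label_event A C k (fun i => x @^-1` D i)); congr (sample_law _).
by apply/seteqP; split=> w /= => [[[? ?] ?]|[]].
Qed.

Lemma uniform_bounded_arity B : (forall j, #|` x j| <= B)%N ->
  bounded_arity B uniform_sample_law.
Proof.
move=> xB A BA; rewrite /uniform_sample_law /distribution/= /pushforward drawE.
rewrite big1 ?mul0r// => j _; rewrite memNset// => /= xA.
by move: BA; rewrite -xA ltnNge xB.
Qed.

End Realization.

(** The labels L are kept in the conclusion: computations take place on them, and
    the samples only serve to compare with the model. *)
Lemma uniform_realization (R : realType) (M B : nat) (S : countType)
    (x : 'I_M.+1 -> sample S) (r t : R) :
  0 < r -> 0 < t -> (forall j, #|` x j| <= B)%N ->
  exists (mu : probability (sample S) R) (d : measure_display)
    (Om : measurableType d) (P : probability Om R)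
    (X : nat -> {RV P >-> sample S}) (n m : {RV P >-> nat}) (L : nat -> Om -> 'I_M.+1),
  [/\ bounded_arity B mu, poissonized_model mu r t X n m,
      poisson_labels P t (r * t) (fun=> M.+1%:R^-1) n m L &
      forall i w, X i w = x (L i w)].
Proof.
move=> r0 t0 xB; have rt0 := mulr_gt0 r0 t0.
exists (uniform_sample_law x t (r * t)), _, (sample_space R), (sample_law t (r * t)).
exists (draw x), (@first_size R), (@second_size R), (@label R M).
split.
- exact: uniform_bounded_arity.
- exact: uniform_poissonized_model.
- exact: uniform_poisson_labels.
- by [].
Qed.

(** * Species that come in blocks *)

Section Blocks.
Context (M B : nat).
Notation S := ('I_M.+1 * 'I_B)%type.

Definition block (j : 'I_M.+1) : sample S := [fset x in [seq (j, b) | b <- enum 'I_B]]%fset.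

Lemma in_block j (s : S) : (s \in (block j : {fset S})) = (s.1 == j).
Proof.
rewrite /block !inE; apply/mapP/eqP => [[b _ ->]//|<-].
by exists s.2; [rewrite mem_enum|case: s].
Qed.

Lemma card_block j : #|` block j| = B.
Proof.
rewrite /block card_fseq undup_id ?size_map -?enumT ?size_enum_ord//.
by rewrite map_inj_uniq ?enum_uniq// => b b' [].
Qed.

Implicit Types ds : seq 'I_M.+1.

Lemma occ_blocks ds (s : S) : occ (map block ds) s = count_mem s.1 ds.
Proof.
by rewrite /occ count_map; apply: eq_count => j /=; rewrite in_block eq_sym.
Qed.

(** Species of one block are seen together, so only the new blocks matter. *)
Lemma nunseen_blocks (R : realType) ds ds' :
  nunseen R (map block ds) (map block ds') =
  B%:R * \sum_(j <- [seq j <- index_enum 'I_M.+1 | j \notin ds]) (1 - (j \notin ds')%:R).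
Proof.
rewrite (nunseen_sum R (index_enum_uniq S)) => [|s _]; last exact: mem_index_enum.
under eq_bigr do rewrite !occ_blocks.
rewrite -(pair_bigA _ (fun j _ => (0 < count_mem j ds + count_mem j ds')%N%:R
   - (0 < count_mem j ds)%N%:R))/=.
rewrite big_filter [in RHS]big_mkcond mulr_sumr/=; apply: eq_bigr => j _.
rewrite (eq_bigr (fun=> if j \notin ds then 1 - (j \notin ds')%:R else 0 : R)).
  by rewrite sumr_const card_ord -[LHS]mulr_natl.
move=> b _; rewrite addn_gt0 -!has_count !has_pred1.
case: (j \in ds) => /=; first by rewrite subrr.
by rewrite subr0; case: (j \in ds'); rewrite ?subr0 ?subrr.
Qed.

End Blocks.

(** * The new blocks given the first expedition *)

Section LabelSums.
Context (R : realType) (M : nat).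
Implicit Types j : 'I_M.+1.

Lemma sum_indicator j : \sum_(c < M.+1) (c == j)%:R = 1 :> R.
Proof. by rewrite (bigD1 j)//= eqxx big1 ?addr0// => c /negbTE ->. Qed.

Lemma sum_nindicator j : \sum_(c < M.+1) (c != j)%:R = M.+1%:R - 1 :> R.
Proof.
transitivity (\sum_(c < M.+1) (1 - (c == j)%:R) : R).
  by apply: eq_bigr => c _; case: (c == j); rewrite ?subrr ?subr0.
by rewrite sumrB sum_indicator sumr_const card_ord.
Qed.

Lemma prod_notin (x : seq 'I_M.+1) j : \prod_(c <- x) (c != j)%:R = (j \notin x)%:R :> R.
Proof.
elim: x => [|c x IHx]; first by rewrite big_nil.
by rewrite big_cons IHx inE negb_or eq_sym -mulnb natrM.
Qed.

End LabelSums.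

Section SecondExpedition.
Context (R : realType) d (Om : measurableType d) (P : probability Om R) (M : nat)
  (a b : R) (n m : Om -> nat) (L : nat -> Om -> 'I_M.+1).
Hypothesis b0 : 0 < b.
Let K : R := M.+1%:R.
Hypothesis labels : poisson_labels P a b (fun=> K^-1) n m L.
Let fo := first_obs L n.
Let so := second_obs L n m.

(** The probability that the second expedition misses a given block. *)
Definition miss_prob : R := expR (- (b / K)).
Let e := miss_prob.

Let K0 : K != 0. Proof. by rewrite pnatr_eq0. Qed.

Lemma first_obs_eqE (x : seq 'I_M.+1) w :
  (fo w == x)%:R = (n w == size x)%:R * \prod_(i < size x) (L i w == nth ord0 x i)%:R :> R.
Proof.
have [nw|nw] := eqVneq (n w) (size x); last first.
  rewrite mul0r; case: eqP => // xE; move/eqP: nw; case.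
  by rewrite -xE /fo /first_obs size_map size_iota.
rewrite mul1r; case: eqP => [xE|xE].
  rewrite big1// => i _; have ix := ltn_ord i.
  have <- : nth ord0 (fo w) i = nth ord0 x i by rewrite xE.
  by rewrite (nth_map 0%N) ?size_iota ?nw// nth_iota ?nw// add0n eqxx.
have [i xi] : exists i : 'I_(size x), L i w != nth ord0 x i.
  apply: contrapT => H; apply: xE; apply: (@eq_from_nth _ ord0).
    by rewrite size_map size_iota.
  move=> i; rewrite size_map size_iota nw => ix.
  rewrite (nth_map 0%N) ?size_iota ?nw// nth_iota ?nw// add0n.
  by apply/eqP/negPn/negP => xi; apply: H; exists (Ordinal ix).
by rewrite (bigD1 i)//= (negbTE xi) mul0r.
Qed.

Let first_prob (x : seq 'I_M.+1) := poisson_pmf a (size x) * K ^- size x.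

Lemma has_expectation_first_eq (x : seq 'I_M.+1) (v : 'I_M.+1 -> R) :
  (forall c, `|v c| <= 1) ->
  has_expectation P (fun w => (fo w == x)%:R * \prod_(c <- so w) v c)
    (first_prob x * expR (b * ((\sum_c v c) / K - 1))).
Proof.
move=> v1.
have f1 i c : `|(c == nth ord0 x i)%:R : R| <= 1 by rewrite normr_nat lern1 leq_b1.
have := has_expectation_first_second b0 labels (size x) f1 v1.
rewrite mulr_suml [X in _ * X * _](_ : _ = K ^- size x).
  by apply: has_expectation_eq => w; rewrite first_obs_eqE.
rewrite (eq_bigr (fun=> K^-1)) ?prodr_const ?card_ord ?exprVn// => i _.
rewrite (bigD1 (nth ord0 x i))//= eqxx mul1r big1 ?addr0// => c /negbTE ->.
by rewrite mul0r.
Qed.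

Let sum_cst1 : \sum_(c < M.+1) (1 : R) = K.
Proof. by rewrite sumr_const card_ord. Qed.

Lemma has_expectation_missed (x : seq 'I_M.+1) j :
  has_expectation P (fun w => (fo w == x)%:R * (j \notin so w)%:R) (first_prob x * e).
Proof.
have v1 c : `|(c != j)%:R : R| <= 1 by rewrite normr_nat lern1 leq_b1.
have := has_expectation_first_eq x v1.
rewrite sum_nindicator -/K.
rewrite mulrBl divff// mul1r addrAC subrr add0r mulrN.
by apply: has_expectation_eq => w; rewrite prod_notin.
Qed.

Lemma has_expectation_missed2 (x : seq 'I_M.+1) i j :
  has_expectation P
    (fun w => (fo w == x)%:R * ((i \notin so w)%:R * (j \notin so w)%:R))
    (first_prob x * (e ^+ 2 + (i == j)%:R * (e - e ^+ 2))).
Proof.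
have [->|ij] := eqVneq i j.
  rewrite mul1r addrC subrK; apply: has_expectation_eq (has_expectation_missed x j) => w.
  by case: (j \notin so w); rewrite ?mulr1 ?mulr0.
rewrite mul0r addr0.
have v1 c : `|(c != i)%:R * (c != j)%:R : R| <= 1.
  by rewrite -natrM mulnb normr_nat lern1 leq_b1.
have := has_expectation_first_eq x v1.
have -> : \sum_c (c != i)%:R * (c != j)%:R = K - 1 - 1 :> R.
  transitivity (\sum_(c < M.+1) (1 - (c == i)%:R - (c == j)%:R) : R).
    apply: eq_bigr => c _; have [->|_] := eqVneq c i.
      by rewrite (negbTE ij) mul0r subrr subr0.
    by rewrite mul1r subr0; case: (c == j); rewrite ?subrr ?subr0.
  by rewrite !sumrB sum_cst1 !sum_indicator.
rewrite (_ : b * _ = - (b / K) + - (b / K)); last by field.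
rewrite expRD -expr2; apply: has_expectation_eq => w.
by rewrite big_split/= !prod_notin.
Qed.

(** Given that the first expedition is x, the N blocks outside x are missed by the
    second one independently, with probability e each; this is the variance plus
    squared bias of the number of hits. *)
Lemma conditional_second_moment (x : seq 'I_M.+1) (c : R)
    (N := size [seq j <- index_enum 'I_M.+1 | j \notin x]) :
  has_expectation P (fun w => (fo w == x)%:R *
    ((\sum_(j <- [seq j <- index_enum 'I_M.+1 | j \notin x]) (1 - (j \notin so w)%:R)) - c) ^+ 2)
    (first_prob x * (N%:R * (e * (1 - e)) + (N%:R * (1 - e) - c) ^+ 2)).
Proof.
set s := [seq j <- _ | _] in N *.
have n11 (c' : 'I_M.+1) : `|1 : R| <= 1 by rewrite normr1.
have E0 := has_expectation_first_eq x n11.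
have E1 := has_expectation_sum s (has_expectation_missed x).
have E2 := has_expectation_sum s (fun i => has_expectation_sum s
  (has_expectation_missed2 x i)).
have := has_expectationD (has_expectationB (has_expectationZ ((N%:R - c) ^+ 2) E0)
  (has_expectationZ (2 * (N%:R - c)) E1)) E2.
rewrite sum_cst1 divff// subrr mulr0 expR0 mulr1.
have sumN (y : R) : \sum_(j <- s) y = N%:R * y.
  by rewrite big_const_seq count_predT iter_addr_0 mulr_natl.
have us : uniq s by rewrite filter_uniq// index_enum_uniq.
have -> : \sum_(i <- s) \sum_(j <- s) first_prob x * (e ^+ 2 + (i == j)%:R * (e - e ^+ 2)) =
   first_prob x * (N%:R * (N%:R * e ^+ 2 + (e - e ^+ 2))).
  rewrite -sumN mulr_sumr; apply: eq_big_seq => i si.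
  rewrite -mulr_sumr big_split/= sumN -mulr_suml.
  congr (_ * (_ + _)); rewrite (bigD1_seq i)//= eqxx big1 ?addr0 ?mul1r// => j.
  by rewrite eq_sym => /negbTE ->.
rewrite sumN.
rewrite [X in has_expectation _ _ X](_ : _ =
  first_prob x * (N%:R * (e * (1 - e)) + (N%:R * (1 - e) - c) ^+ 2)); last by ring.
apply: has_expectation_eq => w.
rewrite big1_eq mulr1 -mulr_sumr.
have -> : \sum_(i <- s) \sum_(j <- s) (fo w == x)%:R *
    ((i \notin so w)%:R * (j \notin so w)%:R) =
    (fo w == x)%:R * (\sum_(j <- s) (j \notin so w)%:R) ^+ 2 :> R.
  rewrite expr2 mulr_suml mulr_sumr; apply: eq_bigr => i _.
  by rewrite -mulr_sumr -mulr_sumr.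
rewrite sumrB sumN mulr1; ring.
Qed.

End SecondExpedition.

(** * Risk for finitely many blocks *)

Section BlockLowerBound.
Context (R : realType) (B : nat) (r t : R) (est : estimator R).
Hypotheses (B1 : (1 <= B)%N) (r0 : 0 < r) (t0 : 0 < t).

Lemma sum_eq_tuple_le1 (T : finType) (y : seq T) K0 :
  \sum_(k < K0) \sum_(x : k.-tuple T) (y == x)%:R <= 1 :> R.
Proof.
have inner k : \sum_(x : k.-tuple T) (y == x)%:R = (size y == k)%:R :> R.
  have [yk|yk] := eqVneq (size y) k.
    have y_k : size y == k by rewrite yk.
    rewrite (bigD1 (Tuple y_k))//= eqxx big1 ?addr0// => x xy.
    by case: eqP => // yx; move/eqP: xy; case; apply/val_inj.
  by rewrite big1// => x _; case: eqP => // yx; move: yk; rewrite yx size_tuple eqxx.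
under eq_bigr do rewrite inner.
have [yK|yK] := ltnP (size y) K0.
  rewrite (bigD1 (Ordinal yK))//= eqxx big1 ?addr0// => k kO.
  by case: eqP => // yk; move/eqP: kO; case; apply/val_inj.
rewrite big1 ?ler01// => k _; case: eqP => // yk.
by move: yK; rewrite yk leqNgt ltn_ord.
Qed.

Lemma sum_uniq_tuples (T : finType) k :
  \sum_(x : k.-tuple T) (uniq x)%:R = (#|T| ^_ k)%:R :> R.
Proof.
rewrite -(card_uniq_tuples k (mem T)) -sum1_card natr_sum [RHS]big_mkcond/=.
apply: eq_bigr => x _; rewrite !inE.
by rewrite (_ : all _ _)/=; [case: uniq|apply/allP => y _].
Qed.

Lemma size_unseen_labels M (x : seq 'I_M.+1) : uniq x ->
  size [seq j <- index_enum 'I_M.+1 | j \notin x] = (M.+1 - size x)%N.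
Proof.
move=> ux; apply/esym; rewrite -[X in (X - _)%N](card_ord M.+1) -(cardC (mem x)).
rewrite (card_uniqP ux) addKn size_filter -sum1_card -sum1_count.
by apply: eq_bigl => j; rewrite !inE.
Qed.

(** Restricting the risk to first expeditions without repetition loses nothing in
    the limit, and there both the number of unseen blocks and the data of a SEP
    estimator depend on the size k only.  The factor ffact / power is the
    probability that k draws are distinct. *)
Lemma block_lower_bound (M K0 : nat) (g : nat -> R) (e := expR (- (r * t / M.+1%:R))) :
  (forall x : seq 'I_M.+1, uniq x -> g (size x) <=
     (M.+1 - size x)%:R * (e * (1 - e)) +
     ((M.+1 - size x)%:R * (1 - e)
        - est r t (map (@block M B) x) / B%:R) ^+ 2) ->
  ((\sum_(k < K0) poisson_pmf t k * ((M.+1 ^_ k)%:R / M.+1%:R ^+ k) * (B%:R ^+ 2 * g k))%:E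
    <= worst_mse B r t est)%E.
Proof.
move=> gH; have B0 : B%:R != 0 :> R by rewrite pnatr_eq0 -lt0n.
have [mu [d [Om [P [X [n [m [L [arity model labels XL]]]]]]]]] :=
  uniform_realization (B := B) r0 t0 (fun j => eq_leq (@card_block M B j)).
apply: (@le_trans _ _ (mse r t X n m est)); last first.
  by apply: ereal_sup_ubound; exists ('I_M.+1 * 'I_B)%type, mu, d, Om, P, X, n, m; split.
have rt0 := mulr_gt0 r0 t0.
pose fo := first_obs L n; pose so := second_obs L n m.
have feE w : first_expedition X n w = map (@block M B) (fo w).
  by rewrite /fo /first_obs -map_comp; apply: eq_map => i; exact: XL.
have seE w : second_expedition X n m w = map (@block M B) (so w).
  by rewrite /so /second_obs -map_comp; apply: eq_map => i; exact: XL.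
pose c (x : seq 'I_M.+1) := est r t (map (@block M B) x) / B%:R.
pose ul (x : seq 'I_M.+1) := [seq j <- index_enum 'I_M.+1 | j \notin x].
pose H (x : seq 'I_M.+1) w := ((\sum_(j <- ul x) (1 - (j \notin so w)%:R)) - c x) ^+ 2.
pose G w := `|nunseen R (first_expedition X n w) (second_expedition X n m w)
   - est r t (first_expedition X n w)| ^+ 2.
have GE w : G w = B%:R ^+ 2 * H (fo w) w.
  rewrite /G /H real_normK ?num_real// feE seE nunseen_blocks /c -exprMn.
  by congr (_ ^+ 2); field.
have E := has_expectation_sum (index_enum 'I_K0) (fun k : 'I_K0 =>
  has_expectation_sum (index_enum {: k.-tuple 'I_M.+1}) (fun x : k.-tuple 'I_M.+1 =>
    has_expectationZ ((uniq x)%:R * B%:R ^+ 2)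
      (conditional_second_moment rt0 labels x (c x)))).
rewrite /mse expectation.unlock.
have mG : measurable_fun setT G.
  exact: (measurable_expeditions X n m (fun D D' => `|nunseen R D D' - est r t D| ^+ 2)).
have G0 w : 0 <= G w by exact: sqr_ge0.
apply: (le_trans _ (has_expectation_le_integral mG _ G0 E)) => [|w]; last first.
  apply: (@le_trans _ _ (\sum_(k < K0) \sum_(x : k.-tuple 'I_M.+1) (fo w == x)%:R * G w)).
    apply: ler_sum => k _; apply: ler_sum => x _.
    rewrite -/fo -/so -/(ul x) -/(H x w); case: eqP => [<-|_]; last by rewrite !(mul0r, mulr0).
    by rewrite !mul1r -mulrA -GE ler_piMl// lern1 leq_b1.
  under eq_bigr do rewrite -mulr_suml.
  by rewrite -mulr_suml ler_piMl// sum_eq_tuple_le1.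
rewrite lee_fin; apply: ler_sum => k _.
rewrite -[in leLHS](card_ord M.+1) -sum_uniq_tuples card_ord.
rewrite !(mulr_suml, mulr_sumr); apply: ler_sum => x _.
have [ux|ux] := boolP (uniq x); last by rewrite !(mul0r, mulr0).
rewrite size_tuple !mul1r mulrCA ler_wpM2l ?sqr_ge0//.
rewrite ler_wpM2l//; first by rewrite mulr_ge0 ?poisson_pmf_ge0// invr_ge0 exprn_ge0.
have := gH x ux; rewrite size_tuple; congr (_ <= _).
by rewrite size_unseen_labels// size_tuple.
Qed.

End BlockLowerBound.

(** * Infinitely many blocks *)

Section Limits.
Context (R : realType).

Lemma le_ereal_of_cvg (u : nat -> R) (l : R) (w : \bar R) :
  (forall k, ((u k)%:E <= w)%E) -> u @ \oo --> l -> (l%:E <= w)%E.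
Proof.
case: w => [x|_ _|/(_ 0%N)//]; last by rewrite leey.
move=> ux ul; rewrite lee_fin; apply: (cvgr_to_le ul).
by apply: nearW => k; rewrite -lee_fin.
Qed.

Lemma cvg_sum_ord (I : nat) (u : nat -> nat -> R) (l : nat -> R) :
  (forall k, u ^~ k @ \oo --> l k) ->
  (fun M => \sum_(k < I) u M k) @ \oo --> \sum_(k < I) l k.
Proof.
move=> ul; elim: I => [|I IH].
  rewrite big_ord0 (_ : (fun _ => _) = cst 0); first exact: cvg_cst.
  by apply/funext => M; rewrite big_ord0.
rewrite big_ord_recr/= (_ : (fun _ => _) = (fun M => \sum_(k < I) u M k) \+ u ^~ I).
  exact: cvgD.
by apply/funext => M; rewrite big_ord_recr.
Qed.

Lemma cvg_subn_ratio k : (fun M => (M.+1 - k)%:R / M.+1%:R) @ \oo --> (1 : R).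
Proof.
have H : (fun M => 1 - k%:R * M.+1%:R^-1) @ \oo --> (1 : R).
  rewrite -[X in _ --> X]subr0 -[X in 1 - X](mulr0 k%:R).
  by apply: cvgB; [exact: cvg_cst|apply: cvgMr; exact: cvg_harmonic].
apply: cvg_trans H; apply: near_eq_cvg; exists k => // M /= kM.
by rewrite natrB ?leqW// mulrBl divff// pnatr_eq0.
Qed.

Lemma cvg_ffact_ratio k : (fun M => (M.+1 ^_ k)%:R / M.+1%:R ^+ k) @ \oo --> (1 : R).
Proof.
elim: k => [|k IH].
  rewrite (_ : (fun _ => _) = cst 1); first exact: cvg_cst.
  by apply/funext => M; rewrite ffactn0 expr0 divr1.
rewrite (_ : (fun _ => _) = (fun M => (M.+1 ^_ k)%:R / M.+1%:R ^+ k) \*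
   (fun M => (M.+1 - k)%:R / M.+1%:R)).
  by rewrite -[X in _ --> X]mulr1; apply: cvgM => //; exact: cvg_subn_ratio.
apply/funext => M /=; rewrite ffactnSr natrM exprSr invfM; ring.
Qed.

Variables (b : R).
Let e M := expR (- (b / M.+1%:R)).

Lemma cvg_miss_prob : e @ \oo --> (1 : R).
Proof.
have H : (fun M => - (b / M.+1%:R)) @ \oo --> (0 : R).
  by rewrite -oppr0 -(mulr0 b); apply: cvgN; apply: cvgMr; exact: cvg_harmonic.
by rewrite -expR0; apply: (cvg_comp _ _ H); exact: continuous_expR.
Qed.

(** Squeezed between b e and b, by exp y >= 1 + y at y = b / M and at y = - b / M. *)
Lemma cvg_new_blocks k : (fun M => (M.+1 - k)%:R * (1 - e M)) @ \oo --> b.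
Proof.
have H : (fun M => M.+1%:R * (1 - e M)) @ \oo --> b.
  apply: (squeeze_cvgr (f := fun M => b * e M) (h := cst b)).
  - apply: nearW => M; have M0 : 0 < M.+1%:R :> R by rewrite ltr0n.
    have Mn0 : M.+1%:R != 0 :> R by rewrite gt_eqF.
    apply/andP; split.
      rewrite -ler_pdivrMl//.
      have -> : M.+1%:R^-1 * (b * e M) = e M * (b / M.+1%:R) by ring.
      have := ler_wpM2l (expR_ge0 (- (b / M.+1%:R))) (expR_ge1Dx (b / M.+1%:R)).
      by rewrite -expRD addNr expR0 -/(e M) mulrDr mulr1 lerBrDl.
    rewrite /= mulrC -ler_pdivlMr// lerBlDr -lerBlDl.
    exact: expR_ge1Dx.
  - by rewrite -[X in _ --> X]mulr1; apply: cvgMr; exact: cvg_miss_prob.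
  - exact: cvg_cst.
rewrite (_ : (fun _ => _) = (fun M => (M.+1 - k)%:R / M.+1%:R) \*
    (fun M => M.+1%:R * (1 - e M))).
  by rewrite -[X in _ --> X]mul1r; apply: cvgM => //; exact: cvg_subn_ratio.
by apply/funext => M /=; rewrite mulrA divfK// pnatr_eq0.
Qed.

End Limits.

Section PoissonMoments.
Context (R : realType) (t : R).
Hypothesis t0 : 0 < t.

(** Shifting the index by one turns the moment of order j + 1 into t times that of
    order j. *)
Lemma poisson_factorial_moment j :
  series (fun k => (k ^_ j)%:R * poisson_pmf t k) @ \oo --> t ^+ j.
Proof.
elim: j => [|j IH].
  have := @cvg_series_poisson_gen R t 1 t0; rewrite subrr mulr0 expR0 expr0.
  rewrite (_ : (fun k => _) = fun k => (k ^_ 0)%:R * poisson_pmf t k)//.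
  by apply/funext => k; rewrite expr1n mulr1 ffactn0 mul1r.
rewrite -cvg_shiftS/= exprS.
rewrite (_ : (fun _ => _) = series (fun k => t * ((k ^_ j)%:R * poisson_pmf t k))).
  exact: cvg_seriesMl.
apply/funext => n; rewrite /series/= big_nat_recl//= mul0r add0r.
apply: eq_bigr => k _; rewrite ffactSS natrM !poisson_pmfE// factS natrM exprS.
have : k.+1%:R != 0 :> R by rewrite pnatr_eq0.
have : k`!%:R != 0 :> R by rewrite pnatr_eq0 -lt0n fact_gt0.
by move: (k.+1%:R) (k`!%:R) => u v u0 v0; field; rewrite u0 v0.
Qed.

Lemma poisson_quadratic_moment (c a : R) :
  series (fun k => poisson_pmf t k * (c + (c - k%:R * a) ^+ 2)) @ \oo -->
  c + c ^+ 2 - 2 * c * a * t + a ^+ 2 * (t ^+ 2 + t).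
Proof.
have m j x := @cvg_seriesMl R _ x _ (@poisson_factorial_moment j).
pose u j (x : R) k := x * ((k ^_ j)%:R * poisson_pmf t k).
rewrite (_ : series _ = (fun N => series (u 0%N (c + c ^+ 2)) N +
  series (u 1%N (a ^+ 2 - 2 * c * a)) N + series (u 2%N (a ^+ 2)) N)).
  rewrite [X in _ --> X](_ : _ = (c + c ^+ 2) * t ^+ 0 +
    (a ^+ 2 - 2 * c * a) * t ^+ 1 + a ^+ 2 * t ^+ 2); last by ring.
  by apply: cvgD; [apply: cvgD|]; exact: m.
apply/funext => N; rewrite /series/= -!big_split/=; apply: eq_bigr => k _; rewrite /u.
case: k => [|k]; first by rewrite !ffact0n /=; ring.
by rewrite ffactn0 ffactn1 ffactnSr ffactn1 subn1/= natrM -natr1; ring.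
Qed.

(** Minimum over a of a quadratic polynomial, attained at a = r t / (t + 1). *)
Lemma sep_bound (r a : R) : t * r + r ^+ 2 * t ^+ 2 / (t + 1) <=
  r * t + (r * t) ^+ 2 - 2 * (r * t) * a * t + a ^+ 2 * (t ^+ 2 + t).
Proof.
have t10 : 0 < t + 1 by rewrite addr_gt0.
rewrite -subr_ge0 (_ : _ - _ = t * (a * (t + 1) - r * t) ^+ 2 / (t + 1)).
  by rewrite divr_ge0 ?(ltW t10)// mulr_ge0 ?sqr_ge0// ltW.
by field; rewrite gt_eqF.
Qed.

End PoissonMoments.

Section MinimaxLowerBounds.
Context (R : realType) (B : nat) (r t : R).
Hypotheses (B1 : (1 <= B)%N) (r0 : 0 < r) (t0 : 0 < t).

(** The bound for finitely many blocks holds for each M and each truncation K0 of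
    the Poisson series, so it passes to the limit in M for K0 fixed and then in K0:
    no interchange of limits is involved. *)
Lemma worst_mse_ge_series (est : estimator R) (g : nat -> nat -> R) (h : nat -> R) (H : R) :
  (forall M (x : seq 'I_M.+1) (e := expR (- (r * t / M.+1%:R))), uniq x -> g M (size x) <=
     (M.+1 - size x)%:R * (e * (1 - e)) +
     ((M.+1 - size x)%:R * (1 - e)
        - est r t ('I_M.+1 * 'I_B)%type (map (@block M B) x) / B%:R) ^+ 2) ->
  (forall k, g ^~ k @ \oo --> h k) ->
  series (fun k => poisson_pmf t k * h k) @ \oo --> H ->
  ((B%:R ^+ 2 * H)%:E <= worst_mse B r t est)%E.
Proof.
move=> gE gh hH.
apply: (@le_ereal_of_cvg _ (series (fun k => B%:R ^+ 2 * (poisson_pmf t k * h k)))); last first.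
  exact: cvg_seriesMl.
move=> K0; rewrite /series/= big_mkord.
apply: (@le_ereal_of_cvg _ (fun M => \sum_(k < K0) poisson_pmf t k *
  ((M.+1 ^_ k)%:R / M.+1%:R ^+ k) * (B%:R ^+ 2 * g M k))).
  by move=> M; apply: block_lower_bound => // x; exact: gE.
apply: (@cvg_sum_ord _ K0 (fun M k => poisson_pmf t k *
  ((M.+1 ^_ k)%:R / M.+1%:R ^+ k) * (B%:R ^+ 2 * g M k))
  (fun k => B%:R ^+ 2 * (poisson_pmf t k * h k))) => k.
rewrite (_ : B%:R ^+ 2 * _ = poisson_pmf t k * 1 * (B%:R ^+ 2 * h k)); last by ring.
apply: cvgM; last by apply: cvgMr; exact: gh.
by apply: cvgMr; exact: cvg_ffact_ratio.
Qed.

(** Whatever the estimator answers, the conditional variance of the number of new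
    blocks remains. *)
Lemma worst_mse_ge (est : estimator R) : ((B%:R ^+ 2 * r * t)%:E <= worst_mse B r t est)%E.
Proof.
rewrite -mulrA.
apply: (@worst_mse_ge_series est (fun M k => (M.+1 - k)%:R *
  (expR (- (r * t / M.+1%:R)) * (1 - expR (- (r * t / M.+1%:R))))) (fun=> r * t)).
- by move=> M x e _; rewrite lerDl sqr_ge0.
- move=> k; rewrite (_ : (fun _ => _) = (fun M => expR (- (r * t / M.+1%:R)))
      \* (fun M => (M.+1 - k)%:R * (1 - expR (- (r * t / M.+1%:R))))).
    rewrite -[X in _ --> X]mul1r; apply: cvgM; first exact: cvg_miss_prob.
    exact: cvg_new_blocks.
  by apply/funext => M /=; rewrite mulrCA.
- have := @cvg_seriesMl R _ (r * t) _ (@cvg_series_poisson_gen R t 1 t0).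
  rewrite subrr mulr0 expR0 mulr1.
  rewrite (_ : (fun k => _) = fun k => poisson_pmf t k * (r * t))//.
  by apply/funext => k; rewrite expr1n mulr1 mulrC.
Qed.

Lemma worst_mse_ge_linear (est : estimator R) (a : R) :
  (forall M (x : seq 'I_M.+1), uniq x ->
    est r t ('I_M.+1 * 'I_B)%type (map (@block M B) x) = B%:R * ((size x)%:R * a)) ->
  ((B%:R ^+ 2 * (t * r + r ^+ 2 * t ^+ 2 / (t + 1)))%:E <= worst_mse B r t est)%E.
Proof.
move=> estE.
apply: (@le_trans _ _ (B%:R ^+ 2 * (r * t + (r * t) ^+ 2 - 2 * (r * t) * a * t
   + a ^+ 2 * (t ^+ 2 + t)))%:E).
  by rewrite lee_fin ler_wpM2l ?sqr_ge0//; exact: sep_bound.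
have B0 : B%:R != 0 :> R by rewrite pnatr_eq0 -lt0n.
pose e M : R := expR (- (r * t / M.+1%:R)).
apply: (@worst_mse_ge_series est (fun M k => (M.+1 - k)%:R * (e M * (1 - e M)) +
  ((M.+1 - k)%:R * (1 - e M) - k%:R * a) ^+ 2) (fun k => r * t + (r * t - k%:R * a) ^+ 2)).
- by move=> M x e' ux; rewrite estE// mulrAC divff// mul1r.
- move=> k; have E := @cvg_new_blocks R (r * t) k.
  apply: cvgD; last first.
    by apply: cvgM; apply: cvgB => //; exact: cvg_cst.
  rewrite (_ : (fun _ => _) = e \* (fun M => (M.+1 - k)%:R * (1 - e M))).
    by rewrite -[X in _ --> X]mul1r; apply: cvgM => //; exact: cvg_miss_prob.
  by apply/funext => M /=; rewrite mulrCA.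
- exact: poisson_quadratic_moment.
Qed.

End MinimaxLowerBounds.

(** * Linearity of synchronous estimators *)

Section Synchronous.
Context (R : realType).

(** The shift is that of phi, whose index i stands for i + 1 sightings. *)
Definition seen_times (i : nat) : seq (sample unit) := nseq i.+1 [fset tt]%fset.

Lemma phi_seen_times i : phi (seen_times i) = fun k => (k == i : nat).
Proof.
apply/funext => k.
have := @card_fset_set_count unit [:: tt] (fun s => occ (seen_times i) s == k.+1) isT.
rewrite /phi.
rewrite (_ : [set s | occ (seen_times i) s = k.+1] =
   [set s | occ (seen_times i) s == k.+1]%classic); last first.
  by apply/seteqP; split=> s /= /eqP.
move=> ->; last by case; rewrite mem_head.
by rewrite /= addn0 /occ count_nseq inE eqxx mul1n eqSS eq_sym.
Qed.

Lemma phi_ge_size (S : countType) (D : seq (sample S)) i : (size D <= i)%N -> phi D i = 0%N.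
Proof.
move=> Di; rewrite /phi (_ : [set _ | _] = set0) ?fset_set0 ?cardfs0//.
apply/seteqP; split=> s //= sD.
have := count_size (fun A : sample S => s \in (A : {fset S})) D.
by rewrite -/(occ D s) sD leqNgt ltnS Di.
Qed.

Section Additive.
Variable G : (nat -> nat) -> R.
Hypothesis GD : forall f f', fin_supp f -> fin_supp f' ->
  G f + G f' = G (fun i => f i + f' i)%N.

Let fin_supp_bounded N (f : nat -> nat) : (forall i, (N <= i)%N -> f i = 0%N) -> fin_supp f.
Proof.
move=> fN; apply: (sub_finite_set _ (finite_II N)) => i /=.
by case: (ltnP i N) => // /fN ->.
Qed.

Let point c i (k : nat) : nat := (c * (k == i))%N.

Let fin_point c i : fin_supp (point c i).
Proof.
apply: (@fin_supp_bounded i.+1) => k ik; rewrite /point gtn_eqF ?muln0//.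
Qed.

Let G0 : G (fun=> 0%N) = 0.
Proof.
have fin0 : fin_supp (fun=> 0%N) by exact: (@fin_supp_bounded 0%N).
by have /eqP := GD fin0 fin0; rewrite addrC -subr_eq0 addrK => /eqP.
Qed.

Let G_point c i : G (point c i) = c%:R * G (point 1 i).
Proof.
elim: c => [|c IHc].
  by rewrite mul0r -G0; congr G; apply/funext => k; rewrite /point mul0n.
rewrite -natr1 mulrDl mul1r -IHc GD//; congr G; apply/funext => k.
by rewrite /point -mulnDl addn1.
Qed.

(** An additive function of finitely supported sequences is determined by its
    values on the unit sequences. *)
Lemma additive_fin_supp N (f : nat -> nat) : (forall i, (N <= i)%N -> f i = 0%N) ->
  G f = \sum_(i < N) (f i)%:R * G (fun k => (k == i : nat)).
Proof.
have pointE i : point 1 i = fun k => (k == i : nat).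
  by apply/funext => k; rewrite /point mul1n.
elim: N f => [|N IHN] f fN.
  by rewrite big_ord0 -G0; congr G; apply/funext => i; exact: fN.
pose f' i := if (i < N)%N then f i else 0%N.
have f'N i : (N <= i)%N -> f' i = 0%N by rewrite /f' ltnNge => ->.
have fE : f = (fun i => f' i + point (f N) N i)%N.
  apply/funext => i; rewrite /f' /point; case: (ltngtP i N) => iN.
  - by rewrite muln0 addn0.
  - by rewrite muln0 fN.
  - by rewrite iN muln1.
rewrite [in LHS]fE -GD//; last exact: fin_supp_bounded f'N.
rewrite (IHN f' f'N) big_ord_recr/= G_point pointE; congr (_ + _).
by apply: eq_bigr => i _; rewrite /f' ltn_ord.
Qed.

End Additive.

Lemma SEP_linear (est : estimator R) (r t : R) : SEP est -> 0 < r -> 0 < t ->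
  forall (S : countType) (D : seq (sample S)),
  est r t S D = \sum_(i < size D) (phi D i)%:R * est r t unit (seen_times i).
Proof.
move=> [g [estE gD]] r0 t0 S D; rewrite estE//.
rewrite (additive_fin_supp (fun f f' ff ff' => gD r t f f' r0 t0 ff ff') (N := size D)).
  by apply: eq_bigr => i _; rewrite estE// phi_seen_times.
by move=> i; exact: phi_ge_size.
Qed.

(** The linear form in phi, regrouped by species. *)
Lemma SEP_species_sum (est : estimator R) (r t : R) (S : countType) (D : seq (sample S))
    (F : seq S) :
  SEP est -> 0 < r -> 0 < t -> uniq F -> {subset observed_species D <= F} ->
  est r t S D =
  \sum_(s <- F) (if occ D s is k.+1 then est r t unit (seen_times k) else 0).
Proof.
move=> sep r0 t0 uF DF; rewrite (SEP_linear sep r0 t0).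
have phiE i : (phi D i)%:R = \sum_(s <- F) (occ D s == i.+1)%:R :> R.
  rewrite /phi (_ : [set s | occ D s = i.+1] = [set s | occ D s == i.+1]%classic).
    rewrite (card_fset_set_count uF) => [|s /eqP sD]; last first.
      by apply: DF; rewrite -occ_gt0 sD.
    by rewrite -sum1_count natr_sum big_mkcond; apply: eq_bigr => s _; case: ifP.
  by apply/seteqP; split=> s /= /eqP.
under eq_bigr => i _ do rewrite phiE mulr_suml.
rewrite exchange_big/=; apply: eq_bigr => s _.
case sD: (occ D s) => [|k]; first by rewrite big1// => i _; rewrite mul0r.
have kD : (k < size D)%N by rewrite -sD count_size.
rewrite (bigD1 (Ordinal kD))//= eqxx mul1r big1 ?addr0// => i ik.
by case: eqP => [[ki]|_]; [move/eqP: ik; case; apply/val_inj|rewrite mul0r].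
Qed.

Lemma sum_species_blocks M B (f : 'I_M.+1 -> R) :
  \sum_(s : 'I_M.+1 * 'I_B) f s.1 = B%:R * \sum_j f j.
Proof.
rewrite -(pair_bigA _ (fun j _ => f j))/= mulr_sumr; apply: eq_bigr => j _.
by rewrite sumr_const card_ord mulr_natl.
Qed.

(** When no block is repeated all seen species are seen once, and a single
    coefficient of the linear form matters. *)
Lemma SEP_uniq_blocks (est : estimator R) (r t : R) M B (x : seq 'I_M.+1) :
  SEP est -> 0 < r -> 0 < t -> uniq x ->
  est r t ('I_M.+1 * 'I_B)%type (map (@block M B) x) =
  B%:R * ((size x)%:R * est r t unit (seen_times 0)).
Proof.
move=> sep r0 t0 ux; rewrite (SEP_species_sum sep r0 t0 (index_enum_uniq _)) => [|s _];
  last exact: mem_index_enum.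
under eq_bigr do rewrite occ_blocks.
rewrite (sum_species_blocks B (fun j => if count_mem j x is k.+1 then _ else _)).
congr (_ * _); rewrite -(card_uniqP ux) -sum1_card natr_sum mulr_suml [RHS]big_mkcond/=.
apply: eq_bigr => j _; rewrite (count_uniq_mem j ux).
by case: (j \in x); rewrite ?mul1r.
Qed.

End Synchronous.

(** * The count of one block *)

Section CountLaw.
Context (R : realType) d (Om : measurableType d) (P : probability Om R) (M : nat)
  (a b : R) (n m : Om -> nat) (L : nat -> Om -> 'I_M.+1).
Hypotheses (a0 : 0 < a) (b0 : 0 < b).
Let K : R := M.+1%:R.
Hypothesis labels : poisson_labels P a b (fun=> K^-1) n m L.
Let fo := first_obs L n.
Let so := second_obs L n m.

Let K0 : K != 0. Proof. by rewrite pnatr_eq0. Qed.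

Let mn k : measurable [set w | n w = k]. Proof. by case: labels. Qed.
Let mm k : measurable [set w | m w = k]. Proof. by case: labels. Qed.
Let mL i c : measurable [set w | L i w = c]. Proof. by case: labels. Qed.

(** The event is split according to the set I of the draws that carry the label
    j. *)
Lemma has_expectation_binomial j k i :
  has_expectation P (fun w => (n w == k)%:R * (count_mem j (fo w) == i)%:R)
    (poisson_pmf a k * ('C(k, i)%:R * (K^-1 ^+ i * (1 - K^-1) ^+ (k - i)))).
Proof.
(* for l < k, the test that draw l carries the label j exactly when l is in I *)
pose f (I : {set 'I_k}) (l : nat) (c : 'I_M.+1) : R :=
  if (insub l : option 'I_k) is Some l' then ((c == j) == (l' \in I))%:R else 1.
have f1 I l c : `|f I l c| <= 1.
  by rewrite /f; case: insub => [l'|]; rewrite ?normr1// normr_nat lern1 leq_b1.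
have n11 (c : 'I_M.+1) : `|1 : R| <= 1 by rewrite normr1.
have E I := has_expectation_first_second b0 labels k (f1 I) n11.
pose sI := seq.filter (fun I : {set 'I_k} => #|I| == i) (index_enum _).
have := has_expectation_sum sI E.
have fE I (l : 'I_k) c : f I l c = ((c == j) == (l \in I))%:R by rewrite /f valK.
have one : \sum_(c < M.+1) 1 * K^-1 = 1.
  by rewrite -mulr_suml sumr_const card_ord divff.
have -> : \sum_(I <- sI)
    poisson_pmf a k * (\prod_(l < k) \sum_c f I l c * K^-1) *
    expR (b * (\sum_(c < M.+1) 1 * K^-1 - 1)) =
    poisson_pmf a k * ('C(k, i)%:R * (K^-1 ^+ i * (1 - K^-1) ^+ (k - i))).
  rewrite one subrr mulr0 expR0.
  rewrite big_filter/= (eq_bigr (fun=> poisson_pmf a k * (K^-1 ^+ i * (1 - K^-1) ^+ (k - i)))).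
    rewrite sumr_const -[LHS]mulr_natl mulrCA; congr (_ * (_%:R * _)).
    rewrite -[X in 'C(X, _)](card_ord k) -card_draws; apply: eq_card => I.
    by rewrite !inE.
  move=> I /eqP Ii; rewrite mulr1; congr (_ * _).
  rewrite (bigID (mem I))/=; congr (_ * _).
    rewrite (eq_bigr (fun=> K^-1)) ?prodr_const ?Ii// => l lI.
    rewrite -mulr_suml (eq_bigr (fun c => (c == j)%:R)) ?sum_indicator ?mul1r// => c _.
    by rewrite fE lI eqb_id.
  rewrite (eq_bigr (fun=> 1 - K^-1)).
    rewrite prodr_const; congr (_ ^+ _).
    transitivity (#|I| + #|[predC I]| - i)%N; first by rewrite Ii addKn.
    by congr (_ - _)%N; rewrite cardC card_ord.
  move=> l lI; rewrite -mulr_suml (eq_bigr (fun c => (c != j)%:R)) ?sum_nindicator.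
    by rewrite mulrBl divff// mul1r.
  by move=> c _; rewrite fE (negbTE lI) eqbF_neg.
apply: has_expectation_eq => w.
have [nk|nk] := eqVneq (n w) k; last by rewrite mul0r big1// => I _; rewrite !mul0r.
pose I0 := [set l : 'I_k | L l w == j]%SET.
have cI0 : count_mem j (fo w) = #|I0|.
  rewrite /fo /first_obs nk count_map -sum1_count.
  have -> : iota 0 k = index_iota 0 k by rewrite /index_iota subn0.
  by rewrite big_mkord -sum1_card; apply: eq_bigl => l; rewrite /I0 finset.in_set.
have term (I : {set 'I_k}) : \prod_(l < k) f I l (L l w) = (I == I0)%:R.
  have [->|II0] := eqVneq I I0.
    by apply: big1 => l _; rewrite fE inE eqxx.
  have [l Il] : exists l, (l \in I) != (l \in I0).
    apply: contrapT => H; move/eqP: II0; apply; apply/setP => l.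
    by apply/eqP/negPn/negP => Hl; apply: H; exists l.
  rewrite (bigD1 l)//= fE; move: Il; rewrite inE eq_sym => /negbTE ->.
  by rewrite mul0r.
rewrite (eq_bigr (fun I => (I == I0)%:R)) => [|I _]; last first.
  by rewrite big1_eq mulr1 mul1r term.
rewrite mul1r cI0 big_filter/=.
have [I0i|I0i] := boolP (#|I0| == i).
  rewrite (bigD1 I0)//= eqxx big1 ?addr0// => I /andP[_ /negbTE ->] //.
rewrite big1// => I Ii; case: eqP => // IE.
by move: I0i; rewrite -IE Ii.
Qed.

(** Thinning of a Poisson number of draws: the binomial laws sum to a Poisson law
    after the index is shifted by i. *)
Lemma count_mem_poisson j i :
  has_expectation P (fun w => (count_mem j (fo w) == i)%:R) (poisson_pmf (a / K) i).
Proof.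
apply: (@has_expectation_series _ _ _ P n _ (fun k => poisson_pmf a k *
   ('C(k, i)%:R * (K^-1 ^+ i * (1 - K^-1) ^+ (k - i)))) _ 1) => //.
- exact: (measurable_obs mn mm mL (fun x _ => (count_mem j x == i)%:R)).
- by move=> w; rewrite normr_nat lern1 leq_b1.
- by move=> k; exact: has_expectation_binomial.
rewrite -(cvg_shiftn i).
rewrite (_ : (fun _ => _) = series (fun l => ((a / K) ^+ i / i`!%:R) *
    (poisson_pmf a l * (1 - K^-1) ^+ l))).
  rewrite poisson_pmfE; last by rewrite divr_gt0// ltr0n.
  rewrite (mulrC (expR _)); apply: cvg_seriesMl.
  have := @cvg_series_poisson_gen R a (1 - K^-1) a0.
  by rewrite addrAC subrr add0r mulrN.
apply/funext => N; rewrite /series/= addnC.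
rewrite (big_cat_nat _ (leq_addr N i))//= big_nat big1 ?add0r => [|k /andP[_ ki]]; last first.
  by rewrite bin_small// mul0r mulr0.
rewrite -[X in \sum_(X <= _ < _) _]add0n big_addn addKn.
apply: eq_bigr => l _; rewrite addnK !poisson_pmfE//.
have : 'C(l + i, i)%:R * (i`!%:R * l`!%:R) = (l + i)`!%:R :> R.
  by rewrite -!natrM -[in l`!](addnK i l) bin_fact// leq_addl.
move=> <-.
have : i`!%:R != 0 :> R by rewrite pnatr_eq0 -lt0n fact_gt0.
have : l`!%:R != 0 :> R by rewrite pnatr_eq0 -lt0n fact_gt0.
have : 'C(l + i, i)%:R != 0 :> R by rewrite pnatr_eq0 -lt0n bin_gt0 leq_addl.
rewrite exprD exprMn.
move: ('C(l + i, i)%:R) (l`!%:R) (i`!%:R) (K^-1 ^+ i) ((1 - K^-1) ^+ l) => u v y z x u0 v0 y0.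
by field; rewrite u0 v0 y0.
Qed.

(** Both terms have expectation exp (- (1 + r) a / K). *)
Lemma has_expectation_block_error (r : R) j : 0 < r -> r <= 1 -> b = r * a ->
  has_expectation P (fun w => (- r) ^+ count_mem j (fo w)
     - (count_mem j (fo w) + count_mem j (so w) == 0)%N%:R) 0.
Proof.
move=> r0 r1 bE.
have n1 (c : 'I_M.+1) : `|(if c == j then - r else 1)| <= 1.
  by case: eqP => _; rewrite ?normrN ?normr1// gtr0_norm.
have n11 (c : 'I_M.+1) : `|1 : R| <= 1 by rewrite normr1.
have b1 (c : 'I_M.+1) : `|(c != j)%:R : R| <= 1 by rewrite normr_nat lern1 leq_b1.
have E1 := poisson_generating_functional a0 b0 labels n1 n11.
have E2 := poisson_generating_functional a0 b0 labels b1 b1.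
have s1 : \sum_(c < M.+1) 1 * K^-1 = 1.
  by rewrite -mulr_suml sumr_const card_ord divff.
have s2 : \sum_(c < M.+1) (c != j)%:R * K^-1 = 1 - K^-1.
  by rewrite -mulr_suml sum_nindicator mulrBl divff// mul1r.
have s3 : \sum_(c < M.+1) (if c == j then - r else 1) * K^-1 = 1 - (1 + r) * K^-1.
  rewrite -mulr_suml (eq_bigr (fun c => (c != j)%:R - r * (c == j)%:R)).
    by rewrite sumrB sum_nindicator -mulr_sumr sum_indicator; field.
  by move=> c _; case: (c == j) => /=; ring.
have := has_expectationB E1 E2; rewrite s1 s2 s3 -!expRD.
rewrite (_ : _ - _ = 0); last first.
  by apply/eqP; rewrite subr_eq0; apply/eqP; congr expR; rewrite bE; ring.
apply: has_expectation_eq => w; rewrite big1_eq mulr1; congr (_ - _).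
  rewrite -/fo; elim: (fo w) => [|c x IHx]; first by rewrite big_nil.
  by rewrite big_cons IHx /=; case: (c == j); rewrite ?exprS ?mul1r.
have cE (x : seq 'I_M.+1) : (count_mem j x == 0)%N = (j \notin x).
  by apply/eqP/idP => /count_memPn.
by rewrite !prod_notin -natrM mulnb addn_eq0 !cE.
Qed.

End CountLaw.

(** * Means and second moments *)

Section DominatedExpectation.
Context d (Om : measurableType d) (R : realType) (P : probability Om R).

(** Only partial sums of the series of phi against the law of N are needed, so that
    no convergence has to be discussed. *)
Lemma integral_comp_nat_le (N : Om -> nat) (pi phi : nat -> R) (c : R) :
  (forall k, measurable [set w | N w = k]) ->
  (forall i, has_expectation P (fun w => (N w == i)%:R) (pi i)) ->
  (forall i, 0 <= phi i) ->
  (forall k, \sum_(i < k) phi i * pi i <= c) ->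
  (\int[P]_w (phi (N w))%:E <= c%:E)%E.
Proof.
move=> mN Npi phi0 phic.
apply: (@le_integral_eventually _ _ _ P
  (fun k w => \sum_(i < k) phi i * (N w == i)%:R)).
- move=> k; exact: (@measurable_comp_countable _ Om R nat N
    (fun x => \sum_(i < k) phi i * (x == i)%:R) mN).
- by move=> k w; apply: sumr_ge0 => i _; rewrite mulr_ge0.
- move=> w; exists (N w).+1 => // k /= Nk.
  rewrite (bigD1 (Ordinal Nk))//= eqxx mulr1 big1 ?addr0// => i iN.
  by case: eqP => [Ni|]; [move/eqP: iN; case; apply/val_inj|rewrite mulr0].
- move=> k; have [_ ->] := has_expectation_sum (index_enum 'I_k)
    (fun i : 'I_k => has_expectationZ (phi i) (Npi i)).
  by rewrite lee_fin; exact: phic.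
Qed.

Lemma dominated_has_expectation (F G : Om -> R) (c : R) :
  measurable_fun setT F -> measurable_fun setT G ->
  (forall w, `|F w| <= G w) -> (\int[P]_w (G w)%:E <= c%:E)%E ->
  exists v, has_expectation P F v /\ `|v| <= c.
Proof.
move=> mF mG FG Gc.
have normle : (\int[P]_w `|(F w)%:E| <= c%:E)%E.
  apply: le_trans Gc; apply: ge0_le_integral => //.
  - by apply/measurable_EFinP; exact: measurableT_comp.
  - exact/measurable_EFinP.
  - by move=> w _; rewrite lee_fin.
have iF : P.-integrable setT (EFin \o F).
  apply/integrableP; split; first exact/measurable_EFinP.
  by rewrite (le_lt_trans normle)// ltry.
have fin : (\int[P]_w (F w)%:E)%E \is a fin_num by exact: integrable_fin_num iF.
exists (fine (\int[P]_w (F w)%:E)%E); split; first by split => //; rewrite fineK.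
have mEF : measurable_fun setT (EFin \o F) by exact/measurable_EFinP.
rewrite -lee_fin -[(`|_|)%:E]/(`|(fine _)%:E|)%E fineK//.
by apply: le_trans normle; exact: le_abse_integral.
Qed.

(** From F^2 >= 2 v F - v^2; the integral may be infinite. *)
Lemma square_mean_le (F : Om -> R) v : has_expectation P F v ->
  ((v ^+ 2)%:E <= \int[P]_w (F w ^+ 2)%:E)%E.
Proof.
move=> Fv.
have := has_expectationB (has_expectationZ (2 * v) Fv) (has_expectation_cst P (v ^+ 2)).
rewrite (_ : 2 * v * v - v ^+ 2 = v ^+ 2); last by ring.
apply: has_expectation_le_integral => [|w|w]; last exact: sqr_ge0.
- have [/integrableP[/measurable_EFinP mF _] _] := Fv.
  exact: (measurable_funX 2 mF).
- by rewrite -subr_ge0 /= (_ : _ - _ = (F w - v) ^+ 2) ?sqr_ge0//; ring.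
Qed.

End DominatedExpectation.

(** * Deviation from the Good-Toulmin coefficients *)

Section Deviation.
Context (R : realType) (r : R) (est : estimator R).
Hypotheses (r0 : 0 < r) (sep : SEP est).

(** The Good-Toulmin coefficient of a species seen i > 0 times is - (- r)^i. *)
Definition deviation (t : R) (i : nat) : R :=
  if i is k.+1 then est r t (seen_times k) + (- r) ^+ k.+1 else 0.

Lemma good_toulmin_deviation (t : R) (S : countType) (F : seq S) (D : seq (sample S)) :
  0 < t -> uniq F -> {subset observed_species D <= F} ->
  est r t D - good_toulmin r t D = \sum_(s <- F) deviation t (occ D s).
Proof.
move=> t0 uF DF; rewrite (SEP_species_sum sep r0 t0 uF DF) (good_toulmin_sum uF)//.
rewrite opprK -big_split/=; apply: eq_bigr => s _.
by case: (occ D s) => [|k] /=; rewrite ?mul0r ?addr0// mul1r.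
Qed.

Lemma block_error (t : R) M B (x y : seq 'I_M.+1) : 0 < t ->
  nunseen R (map (@block M B) x) (map (@block M B) y)
    - est r t (map (@block M B) x) =
  B%:R * \sum_j ((- r) ^+ count_mem j x - (count_mem j x + count_mem j y == 0)%N%:R
                 - deviation t (count_mem j x)).
Proof.
move=> t0; pose S := ('I_M.+1 * 'I_B)%type.
have all_in (D : seq (sample S)) : {subset observed_species D <= index_enum S}.
  by move=> s _; exact: mem_index_enum.
have := @good_toulmin_error S R _ _ (index_enum_uniq S) r t _
  (all_in (map (@block M B) x ++ map (@block M B) y)).
have := good_toulmin_deviation t0 (index_enum_uniq S) (all_in (map (@block M B) x)).
set e := est _ _ _; set g := good_toulmin _ _ _; set u := nunseen _ _ _ => eg ug.
rewrite (_ : u - e = (u - g) - (e - g)); last by ring.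
rewrite eg ug -sumrB -sum_species_blocks; apply: eq_bigr => s _.
by rewrite /species_error !occ_blocks.
Qed.

(** The risk of the block model written with counts of labels only, where the
    laws computed above apply. *)
Lemma block_mse_le_worst (t : R) M B : 0 < t ->
  exists (d : measure_display) (Om : measurableType d) (P : probability Om R)
    (n m : Om -> nat) (L : nat -> Om -> 'I_M.+1)
    (cnt := fun j w => count_mem j (first_obs L n w))
    (cnt' := fun j w => count_mem j (second_obs L n m w)),
  poisson_labels P t (r * t) (fun=> M.+1%:R^-1) n m L /\
  (\int[P]_w ((B%:R * \sum_j ((- r) ^+ cnt j w - (cnt j w + cnt' j w == 0)%N%:R
      - deviation t (cnt j w))) ^+ 2)%:E <= worst_mse B r t est)%E.
Proof.
move=> t0.
have [mu [d [Om [P [X [n [m [L [arity model labels XL]]]]]]]]] :=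
  uniform_realization (B := B) r0 t0 (fun j => eq_leq (@card_block M B j)).
exists d, Om, P, n, m, L; split; first exact: labels.
apply: (@le_trans _ _ (mse r t X n m est)); last first.
  by apply: ereal_sup_ubound; exists ('I_M.+1 * 'I_B)%type, mu, d, Om, P, X, n, m; split.
rewrite /mse expectation.unlock le_eqVlt; apply/orP; left; apply/eqP.
apply: eq_integral => w _; congr EFin; rewrite real_normK ?num_real//; congr (_ ^+ 2).
rewrite -block_error//.
have -> : first_expedition X n w = map (@block M B) (first_obs L n w).
  by rewrite /first_obs -map_comp; apply: eq_map => i; rewrite /= XL.
have -> // : second_expedition X n m w = map (@block M B) (second_obs L n m w).
by rewrite /second_obs -map_comp; apply: eq_map => i; rewrite /= XL.
Qed.

End Deviation.

(** * Bias of an atemporal estimator *)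

Section AtemporalBias.
Context (R : realType) (r : R) (est : estimator R) (B : nat).
Hypotheses (r0 : 0 < r) (r1 : r <= 1) (sep : SEP est) (B1 : (1 <= B)%N).

(** The block counts are Poisson of parameter x.  The first nonzero deviation h i0
    contributes its full probability to the mean; the later ones contribute at most
    exp (- x) times the sum of |h i| x^i / i!, and for x <= x1 this sum is at most
    (x / x1)^(i0 + 1) C. *)
Lemma bias_lower_bound (t : R) M i0 (x1 C : R) (h := deviation r est t)
    (x := t / M.+1%:R)
    (A := `|h i0| * poisson_pmf x i0 - expR (- x) * ((x / x1) ^+ i0.+1 * C)) :
  0 < t -> 0 < x1 -> x <= x1 ->
  (forall i, (i < i0)%N -> h i = 0) ->
  (forall k, \sum_(i < k) `|h i| * (x1 ^+ i / i`!%:R) <= C) -> 0 <= A ->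
  ((B%:R ^+ 2 * (M.+1%:R * A) ^+ 2)%:E <= worst_mse B r t est)%E.
Proof.
move=> t0 x10 xx1 h0 hC A0.
have [d [Om [P [n [m [L [labels le_worst]]]]]]] := block_mse_le_worst r0 sep M B t0.
apply: (le_trans _ le_worst).
have K0 : 0 < M.+1%:R :> R by rewrite ltr0n.
have x0 : 0 < x by rewrite divr_gt0.
have xx10 : 0 <= x / x1 <= 1.
  by rewrite divr_ge0 ?(ltW x0) ?(ltW x10)//= ler_pdivrMr// mul1r.
pose c := expR (- x) * ((x / x1) ^+ i0.+1 * C).
pose cnt j w := count_mem j (first_obs L n w).
pose psi i := if (i0 < i)%N then `|h i| else 0.
have [mn mm mL _] := labels.
have mcnt j k : measurable [set w | cnt j w = k].
  have := measurable_obs mn mm mL (fun y _ => (count_mem j y)%:R : R).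
  move=> /(_ measurableT [set k%:R] (measurable_set1 _)); rewrite setTI.
  congr (measurable _); apply/seteqP; split=> w /=.
    by move=> /eqP; rewrite eqr_nat => /eqP.
  by rewrite /cnt => ->.
have law j i : has_expectation P (fun w => (cnt j w == i)%:R) (poisson_pmf x i).
  exact: (count_mem_poisson t0 (mulr_gt0 r0 t0) labels).
have psi0 i : 0 <= psi i by rewrite /psi; case: ifP.
have psic k : \sum_(i < k) psi i * poisson_pmf x i <= c.
  apply: (@le_trans _ _ (expR (- x) * ((x / x1) ^+ i0.+1 *
      \sum_(i < k) `|h i| * (x1 ^+ i / i`!%:R)))).
    rewrite !mulr_sumr; apply: ler_sum => i _; rewrite poisson_pmfE//.
    have [i0i|ii0] := ltnP i0 i; last first.
      rewrite /psi ltnNge ii0/= mul0r mulr_ge0 ?expR_ge0// mulr_ge0//.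
        by rewrite exprn_ge0//; case/andP: xx10.
      by rewrite mulr_ge0// divr_ge0// exprn_ge0// ltW.
    rewrite /psi i0i [leLHS]mulrCA ler_wpM2l ?expR_ge0// [leRHS]mulrCA ler_wpM2l//.
    rewrite mulrA ler_wpM2r ?invr_ge0//.
    rewrite -{1}(divfK (lt0r_neq0 x10) x) exprMn ler_wpM2r ?exprn_ge0 ?(ltW x10)//.
    by case/andP: xx10 => ? ?; rewrite ler_wiXn2l.
  rewrite /c ler_wpM2l ?expR_ge0// ler_wpM2l// exprn_ge0//; by case/andP: xx10.
have mean j : exists v, has_expectation P (fun w => h (cnt j w)) v /\
    `|v - h i0 * poisson_pmf x i0| <= c.
  have [v [Ev vc]] : exists v,
      has_expectation P (fun w => h (cnt j w) - h i0 * (cnt j w == i0)%:R) v /\ `|v| <= c.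
    apply: (@dominated_has_expectation _ _ _ _ _ (fun w => psi (cnt j w))).
    - exact: (@measurable_comp_countable _ Om R nat (cnt j) (fun i => h i - h i0 * (i == i0)%:R)).
    - exact: (@measurable_comp_countable _ Om R nat (cnt j) psi).
    - move=> w; rewrite /psi; case: (ltngtP (cnt j w) i0) => [ci|ci|->].
      + by rewrite h0// mulr0 subr0 normr0.
      + by rewrite mulr0 subr0.
      + by rewrite mulr1 subrr normr0.
    - exact: integral_comp_nat_le (mcnt j) (law j) psi0 psic.
  exists (v + h i0 * poisson_pmf x i0); rewrite addrK; split=> //.
  apply: has_expectation_eq (has_expectationD Ev (has_expectationZ (h i0) (law j i0))) => w.
  by rewrite subrK.
pose v j := projT1 (cid (mean j)).
have vE j : has_expectation P (fun w => h (cnt j w)) (v j) by case: (projT2 (cid (mean j))).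
have vc j : `|v j - h i0 * poisson_pmf x i0| <= c by case: (projT2 (cid (mean j))).
have errE := has_expectationZ B%:R (has_expectation_sum (index_enum 'I_M.+1) (fun j =>
  has_expectationB (has_expectation_block_error t0 (mulr_gt0 r0 t0) labels j r0 r1 erefl) (vE j))).
apply: le_trans (square_mean_le errE).
rewrite lee_fin [leRHS]exprMn ler_wpM2l ?sqr_ge0//.
rewrite -[leRHS]real_normK ?num_real// lerXn2r ?nnegrE ?mulr_ge0// ?(ltW K0)//.
pose p := h i0 * poisson_pmf x i0.
have constE (y : R) : \sum_(j < M.+1) y = M.+1%:R * y.
  by rewrite sumr_const card_ord -[LHS]mulr_natl.
have -> : \sum_(j < M.+1) (0 - v j) = - \sum_j v j.
  by rewrite -sumrN; apply: eq_bigr => j _; rewrite sub0r.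
rewrite normrN /A mulrBr -/c lerBlDr -(ger0_norm (poisson_pmf_ge0 x i0)) -normrM -/p.
rewrite -[X in X * _](ger0_norm (ltW K0)) -normrM -constE.
rewrite (_ : \sum_(j < M.+1) p = \sum_j v j - \sum_j (v j - p)); last first.
  by rewrite -sumrB; apply: eq_bigr => j _; ring.
apply: le_trans (ler_normB _ _) _; rewrite lerD2l -constE.
apply: le_trans (ler_norm_sum _ _ _) _; exact: ler_sum.
Qed.

(** With one block the error is the deviation of its count, up to a term bounded
    by 2; and |y| <= 1 + y^2 for that error y, whence the constant 3. *)
Lemma single_block_lower_bound (t : R) k : 0 < t ->
  ((\sum_(i < k) `|deviation r est t i| * poisson_pmf t i - 3)%:E <= worst_mse B r t est)%E.
Proof.
move=> t0; pose h := deviation r est t.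
have [d [Om [P [n [m [L [labels le_worst]]]]]]] := block_mse_le_worst r0 sep 0 B t0.
apply: (le_trans _ le_worst).
have [mn mm mL _] := labels.
pose cnt w := count_mem ord0 (first_obs L n w).
have law i : has_expectation P (fun w => (cnt w == i)%:R) (poisson_pmf t i).
  by have := count_mem_poisson t0 (mulr_gt0 r0 t0) labels ord0 i; rewrite divr1.
have E := has_expectationB (has_expectation_sum (index_enum 'I_k)
  (fun i : 'I_k => has_expectationZ `|h i| (law i))) (has_expectation_cst P 3).
apply: (has_expectation_le_integral _ _ _ E) => [|w|w]; last exact: sqr_ge0.
  exact: (measurable_obs mn mm mL (fun x y => (B%:R * \sum_j ((- r) ^+ count_mem j x
     - (count_mem j x + count_mem j y == 0)%N%:R - h (count_mem j x))) ^+ 2)).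
rewrite big_ord1 -/(cnt w) exprMn.
set z := (_ == 0%N)%:R; pose y := (- r) ^+ cnt w - z - h (cnt w); rewrite -/h -/y.
have hsum : \sum_(i < k) `|h i| * (cnt w == i)%:R <= `|h (cnt w)|.
  have [wk|kw] := ltnP (cnt w) k.
    rewrite (bigD1 (Ordinal wk))//= eqxx mulr1 big1 ?addr0// => i iw.
    by case: eqP => [wi|]; [move/eqP: iw; case; apply/val_inj|rewrite mulr0].
  rewrite big1// => i _; case: eqP => [wi|]; last by rewrite mulr0.
  by move: kw; rewrite wi leqNgt ltn_ord.
have hy : `|h (cnt w)| <= 2 + `|y|.
  have -> : h (cnt w) = (- r) ^+ cnt w - z - y by rewrite /y; ring.
  apply: le_trans (ler_normB _ _) _; rewrite lerD2r.
  apply: le_trans (ler_normB _ _) _; apply: lerD.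
    by rewrite normrX normrN gtr0_norm// exprn_ile1// ltW.
  by rewrite /z normr_nat lern1 leq_b1.
have y2 : `|y| <= 1 + y ^+ 2.
  rewrite -[y ^+ 2]real_normK ?num_real//.
  have := sqr_ge0 (`|y| - 1); have := normr_ge0 y; nra.
have yB : y ^+ 2 <= B%:R ^+ 2 * y ^+ 2.
  by rewrite ler_peMl ?sqr_ge0// expr_ge1// ler1n.
rewrite lerBlDr; apply: le_trans hsum _; apply: le_trans hy _; lra.
Qed.

End AtemporalBias.

(** If the deviations have a series of positive radius, then for x small enough the
    first nonzero term exceeds twice the rest; taking the integer part of t / x0,
    plus one, as number of blocks keeps x = t / (M + 1) between x0 / 2 and x0. *)
Lemma worst_mse_atemporal (R : realType) (r : R) (est : estimator R) :
  0 < r -> r <= 1 -> SEP est -> AT est ->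
  ~ (forall (t : R) (S : countType) (D : seq (sample S)),
       0 < t -> est r t S D = @good_toulmin R r t S D) ->
  exists c : R, 0 < c /\ forall B : nat, (1 <= B)%N ->
    \forall t \near +oo, ((c * (B%:R ^+ 2 * t ^+ 2))%:E <= worst_mse B r t est)%E.
Proof.
move=> r0 r1 sep at_ notGT.
pose h := deviation r est 1.
have hE t : 0 < t -> deviation r est t = h.
  by move=> t0; apply/funext => -[|k]//=; rewrite (at_ r t 1).
have ex_h : exists i, h i != 0.
  apply: contrapT => no_h; apply: notGT => t S D t0; apply/eqP; rewrite -subr_eq0; apply/eqP.
  rewrite (good_toulmin_deviation r0 sep t0 (undup_uniq (observed_species D))).
    rewrite big1// => s _; rewrite hE//; apply/eqP/negPn/negP => hs.
    by apply: no_h; exists (occ D s).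
  by move=> s; rewrite mem_undup.
have [i0 hi0 i0_min] := ex_minnP ex_h.
have h0 i : (i < i0)%N -> h i = 0.
  by move=> ii0; apply/eqP/negPn/negP => /i0_min; rewrite leqNgt ii0.
have [[x1 [x10 [C hC]]]|unbounded] := pselect (exists x1 : R, 0 < x1 /\
    exists C, forall k, \sum_(i < k) `|h i| * (x1 ^+ i / i`!%:R) <= C).
- have C0 : 0 <= C by have := hC 0%N; rewrite big_ord0.
  pose q := `|h i0| / i0`!%:R.
  have q0 : 0 < q by rewrite divr_gt0 ?normr_gt0// ltr0n fact_gt0.
  pose D := C / x1 ^+ i0.+1.
  have D0 : 0 <= D by rewrite divr_ge0// exprn_ge0// ltW.
  (* for x <= x0 the first term q is at least twice the rest x * D *)
  pose x0 := Num.min x1 (q / (2 * (D + 1))).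
  have x00 : 0 < x0.
    by rewrite lt_min x10 divr_gt0// mulr_gt0// ltr_wpDl.
  have x0D : x0 * D <= q / 2.
    have : x0 <= q / (2 * (D + 1)) by rewrite ge_min lexx orbT.
    have D10 : 0 < D + 1 by rewrite ltr_wpDl.
    move=> /(ler_wpM2r D0) /le_trans; apply.
    have -> : q / (2 * (D + 1)) * D = q / 2 * (D / (D + 1)) by field; rewrite gt_eqF.
    rewrite ler_piMr ?divr_ge0 ?(ltW q0)//.
    by rewrite ler_pdivrMr// mul1r lerDl.
  pose beta := expR (- x0) * (x0 / 2) ^+ i0 * (q / 2).
  have beta0 : 0 < beta.
    apply: mulr_gt0; last exact: divr_gt0.
    by apply: mulr_gt0; [exact: expR_gt0|apply: exprn_gt0; exact: divr_gt0].
  exists ((beta / x0) ^+ 2); split; first by rewrite exprn_gt0// divr_gt0.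
  move=> B B1; apply: filterS (nbhs_pinfty_gt (num_real x0)) => t tx0.
  have t0 := lt_trans x00 tx0.
  pose M := Num.truncn (t / x0).
  have /andP[Ml Mu] := truncn_itv (divr_ge0 (ltW t0) (ltW x00)).
  have K0 : 0 < M.+1%:R :> R by rewrite ltr0n.
  have xu : t / M.+1%:R <= x0.
    by rewrite ler_pdivrMr// mulrC -ler_pdivrMr// ltW.
  have xl : x0 / 2 <= t / M.+1%:R.
    rewrite ler_pdivlMr// mulrC mulrA ler_pdivrMr// -natr1 mulrDl mul1r.
    rewrite mulr_natr mulr2n lerD ?(ltW tx0)//.
    by rewrite -ler_pdivlMr.
  set x := t / M.+1%:R in xu xl.
  have xx0 : 0 < x by rewrite divr_gt0.
  pose A := `|h i0| * poisson_pmf x i0 - expR (- x) * ((x / x1) ^+ i0.+1 * C).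
  have Abeta : beta <= A.
    have -> : A = expR (- x) * x ^+ i0 * (q - x * D).
      rewrite /A poisson_pmfE// /q /D [(x / x1) ^+ _]expr_div_n [x ^+ i0.+1]exprS.
      have i0f : i0`!%:R != 0 :> R by rewrite pnatr_eq0 -lt0n fact_gt0.
      have x1n : x1 ^+ i0.+1 != 0 by rewrite expf_neq0// gt_eqF.
      by move: (x1 ^+ i0.+1) x1n => X1 X10; field; rewrite i0f X10.
    rewrite /beta ler_pM ?mulr_ge0 ?expR_ge0 ?exprn_ge0 ?divr_ge0 ?(ltW x00) ?(ltW q0)//.
      rewrite ler_pM ?expR_ge0 ?exprn_ge0 ?divr_ge0 ?(ltW x00)//.
        by rewrite ler_expR lerN2.
      by rewrite lerXn2r ?nnegrE ?(ltW xx0)// divr_ge0 ?(ltW x00).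
    have := ler_wpM2r D0 xu; lra.
  have A0 : 0 <= A := le_trans (ltW beta0) Abeta.
  have := @bias_lower_bound R r est B r0 r1 sep t M i0 x1 C t0 x10.
  have xx1 : x <= x1 by rewrite (le_trans xu)// ge_min lexx.
  rewrite hE// -/x -/A => /(_ xx1 h0 hC A0) H; apply: le_trans H.
  have slope : beta / x0 * t <= M.+1%:R * A.
    have -> : beta / x0 * t = t / x0 * beta by ring.
    by rewrite ler_pM ?(ltW beta0)// ?(ltW Mu)// divr_ge0// ltW.
  have slope0 : 0 <= beta / x0 * t by rewrite mulr_ge0 ?(ltW t0)// divr_ge0// ltW.
  rewrite lee_fin mulrCA ler_wpM2l ?sqr_ge0// -exprMn.
  by rewrite lerXn2r// nnegrE// (le_trans slope0).
- exists 1; split => // B B1; apply: filterS (nbhs_pinfty_gt (num_real 0)) => t t0.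
  pose c := expR t * (B%:R ^+ 2 * t ^+ 2 + 3).
  have [k hk] : exists k, c < \sum_(i < k) `|h i| * (t ^+ i / i`!%:R).
    apply: contrapT => no_k; apply: unbounded; exists t; split => //; exists c => k.
    by rewrite leNgt; apply/negP => hk; apply: no_k; exists k.
  apply: le_trans (single_block_lower_bound r0 r1 sep B1 k t0).
  rewrite lee_fin mul1r lerBrDr hE//.
  rewrite (eq_bigr (fun i : 'I_k => expR (- t) * (`|h i| * (t ^+ i / i`!%:R)))).
    rewrite -mulr_sumr -(ler_pM2l (expR_gt0 t)) [leRHS]mulrA -expRD subrr expR0 mul1r.
    exact: ltW.
  by move=> i _; rewrite poisson_pmfE// mulrCA.
Qed.

Theorem theorem14 (R : realType) (r : R) (hr0 : 0 < r) (hr1 : r <= 1) :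
  (forall (B : nat) (t : R), (1 <= B)%N -> 0 < t ->
    [/\ (* (1) *)
        forall (S : countType) (mu : probability (sample S) R)
               (d : measure_display) (Om : measurableType d)
               (P : probability Om R)
               (X : nat -> {RV P >-> sample S}) (n m : {RV P >-> nat}),
          bounded_arity B mu -> poissonized_model mu r t X n m ->
          (mse r t X n m (@good_toulmin R) <=
             (B%:R * r * (r + 1) - r)%:E * mean_seen X n
             + mean_unseen X n m)%E /\
          ((B%:R * r * (r + 1) - r)%:E * mean_seen X n
             + mean_unseen X n m <=
             (B%:R ^+ 2 * r * (r + 1) * t)%:E)%E,
        (* (2) *)
        ((B%:R ^+ 2 * r * t)%:E <=
           minimax_mse (fun _ : estimator R => True) B r t)%E &
        (* (3) *)
        ((B%:R ^+ 2 * (t * r + r ^+ 2 * t ^+ 2 / (t + 1)))%:E <=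
           minimax_mse (@SEP R) B r t)%E]) /\
  (* (4) *)
  (forall est : estimator R, SEP est -> AT est ->
    ~ (forall (t : R) (S : countType) (D : seq (sample S)),
         0 < t -> est r t S D = @good_toulmin R r t S D) ->
    exists c : R, 0 < c /\
      forall B : nat, (1 <= B)%N ->
        \forall t \near +oo,
          ((c * (B%:R ^+ 2 * t ^+ 2))%:E <= worst_mse B r t est)%E).
Proof.
split=> [B t B1 t0|est]; last exact: worst_mse_atemporal.
split.
- move=> S mu d Om P X n m arity model; split.
    exact: good_toulmin_mse_le arity model B1 hr0 hr1 t0.
  exact: mean_counts_le arity model B1 hr0 hr1 t0.
- by apply/ereal_infP => _ [est [_ ->]]; exact: worst_mse_ge.
- apply/ereal_infP => _ [est [sep ->]].
  apply: (worst_mse_ge_linear B1 hr0 t0) => M x ux.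
  exact: SEP_uniq_blocks.
Qed.
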